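(* Let $\{S_i : X \to X\}_{i\in I}$ be a conformal iterated function system (CIFS) on $X\subset\mathbb{R}^d$, with limit set $F$, with $V$ the open set and $\overline{S_i}: V\to V$ the conformal extensions from the definition of a CIFS. Assume that $\overline{S_i}(V)\cap\overline{S_j}(V)=\varnothing$ for all distinct $i,j\in I$. Let $P$ be a subset of $\bigcup_{i\in I} S_i(X)$ intersecting $S_i(X)$ in exactly one point for each $i\in I$. Then $$\dim_{\mathrm A} F=\max\{\dim_{\mathrm H}F,\ \dim_{\mathrm A}P\}.$$
   Context: Notation: $\mathbb{N}=\{1,2,3,\dots\}$; $B(x,r)$ is the open Euclidean ball; $\mathcal{L}^d$ is Lebesgue measure; $N_r(E)$ is the smallest number of balls of radius $r$ needed to cover $E$; $\dim_{\mathrm H}$ is Hausdorff dimension. CIFS: Let $d\in\mathbb{N}$, let $X$ be a compact connected subset of $\mathbb{R}^d$, let $I$ be a (non-empty) countable index set (finite or infinite), and let $S_i:X\to X$, $i\in I$. Put $I^*=\bigcup_{n\ge1}I^n$ (finite words), and for $w=w_1\cdots w_n\in I^n$ put $S_w=S_{w_1}\circ\cdots\circ S_{w_n}$. The system is a CIFS if: (1) (Open Set Condition) $U:=\mathrm{Int}_{\mathbb{R}^d}X\neq\varnothing$, $S_i(U)\subset U$ for all $i$, and $S_i(U)\cap S_j(U)=\varnothing$ for $i\ne j$; (2) (Cone condition) $\inf_{x\in X}\inf_{r\in(0,1)}\mathcal{L}^d(B(x,r)\cap \mathrm{Int}_{\mathbb{R}^d}X)/r^d>0$; (3) (Conformality)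 there is an open, bounded, connected $V\subset\mathbb{R}^d$ with $X\subset V$ and $\epsilon>0$ such that each $S_i$ extends to a $C^{1+\epsilon}$ diffeomorphism $\overline{S_i}$ from $V$ onto an open subset of $V$, which is conformal on $V$: for all $x\in V$ the differential $\overline{S_i}'|_x$ exists, is non-zero, is a similarity map ($\|\overline{S_i}'|_x(y)\|=\|\overline{S_i}'|_x\|\,\|y\|$ for all $y\in\mathbb{R}^d$), and is $\epsilon$-Hölder continuous in $x$. Moreover there is $\xi\in(0,1)$ with $\|\overline{S_i}'\|<\xi$ for all $i\in I$, where $\|\cdot\|$ is the supremum norm over $V$; (4) (Bounded distortion) there is $K>0$ with $\|S_w'|_y\|\le K\|S_w'|_x\|$ for all $x,y\in V$, $w\in I^*$ (derivatives of the composed extensions). The limit set is $F=\bigcup_{w\in I^{\mathbb{N}}}\bigcap_{n\ge1}S_{w|_n}(X)$, where $w|_n=w_1\cdots w_n$. The Assouad dimension of a non-empty bounded $E\subset\mathbb{R}^d$ is $\dim_{\mathrm A}E=\inf\{\alpha:\exists C>0\ \forall x\in E\ \forall\,0<r<R,\ N_r(B(x,R)\cap E)\le C(R/r)^\alpha\}$. *)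

(* Defs.v *)
From mathcomp Require Import all_boot all_order all_algebra.
From mathcomp Require Import all_classical all_reals all_analysis.

Set Implicit Arguments.
Unset Strict Implicit.
Unset Printing Implicit Defensive.

Import Order.TTheory GRing.Theory Num.Theory.
Import numFieldNormedType.Exports.

Local Open Scope classical_set_scope.
Local Open Scope ring_scope.

(* The norm of MathComp-Analysis on 'rV[R]_d is the sup norm.  It is used only
   for notions that do not depend on the choice of a norm (the topology,
   boundedness, differentiability and the differential 'd); every metric
   quantity below is computed with the Euclidean norm [enorm]. *)

Section Euclidean.
Context {R : realType} {d : nat}.
Local Notation E := 'rV[R]_d.

Definition enorm (x : E) : R := Num.sqrt (\sum_(i < d) x 0 i ^+ 2).

Definition eball (x : E) (r : R) : set E := [set y | enorm (y - x) < r].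

Definition ediam (A : set E) : \bar R :=
  ereal_sup [set z | exists x y, [/\ A x, A y & z = (enorm (x - y))%:E]].

(* Operator norm for the Euclidean norm; meant for linear [L], for which the
   set is bounded. *)
Definition opnorm (L : E -> E) : R :=
  sup [set enorm (L h) | h in [set h | enorm h <= 1]].

(* Lebesgue measure on R^d, as the Lebesgue outer measure; here it is only
   evaluated at open sets. *)
Definition box (a b : E) : set E := [set x | forall i, a 0 i <= x 0 i < b 0 i].

Definition lebesgue_Rd (A : set E) : \bar R :=
  ereal_inf [set z | exists a b : nat -> E,
    [/\ forall k i, a k 0 i <= b k 0 i,
        A `<=` \bigcup_k box (a k) (b k) &
        z = (\sum_(0 <= k <oo) (\prod_(i < d) (b k 0 i - a k 0 i))%:E)%E]].

(* N_r(A); it is +oo when finitely many balls do not suffice. *)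
Definition covering_number (r : R) (A : set E) : \bar R :=
  ereal_inf [set n%:R%:E | n in [set n : nat |
    exists c : 'I_n -> E, A `<=` \bigcup_i eball (c i) r]].

Definition assouad_dim (A : set E) : \bar R :=
  ereal_inf [set alpha%:E | alpha in [set alpha : R |
    exists2 C : R, 0 < C & forall (x : E) (r rho : R),
      A x -> 0 < r -> r < rho ->
      (covering_number r (eball x rho `&` A)
         <= (C * (rho / r) `^ alpha)%:E)%E]].

(* [diam_pow s A] is diam(A)^s, with value 0 at the empty set even for s = 0
   and value 1 at nonempty sets for s = 0. *)
Definition diam_pow (s : R) (A : set E) : \bar R :=
  if A == set0 then 0%E else (ediam A `^ s)%E.

Definition hausdorff_content (s delta : R) (A : set E) : \bar R :=
  ereal_inf [set z | exists U : nat -> set E,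
    [/\ A `<=` \bigcup_k U k,
        forall k, (ediam (U k) <= delta%:E)%E &
        z = (\sum_(0 <= k <oo) diam_pow s (U k))%E]].

Definition hausdorff_measure (s : R) (A : set E) : \bar R :=
  ereal_sup [set hausdorff_content s delta A | delta in [set delta : R | 0 < delta]].

Definition hausdorff_dim (A : set E) : \bar R :=
  ereal_inf [set s%:E | s in [set s : R | 0 <= s /\ hausdorff_measure s A = 0%E]].

Definition holder_diff_on (e : R) (A : set E) (f : E -> E) : Prop :=
  exists C : R, forall x y, A x -> A y ->
    opnorm (fun h => 'd f x h - 'd f y h) <= C * enorm (x - y) `^ e.

Definition C1_holder (e : R) (A : set E) (f : E -> E) : Prop :=
  (forall x, A x -> differentiable f x) /\
  (forall x, A x -> exists2 r : R, 0 < r & holder_diff_on e (A `&` eball x r) f).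

(* [f] is a C^{1+e} diffeomorphism from the open set [V] onto the open set
   [f @` V]; only the values of [f] on [V] matter. *)
Definition C1_holder_diffeo (e : R) (V : set E) (f : E -> E) : Prop :=
  [/\ open V, open (f @` V), C1_holder e V f &
      exists2 g : E -> E, forall x, V x -> g (f x) = x & C1_holder e (f @` V) g].

End Euclidean.

Section CIFS.
Context {R : realType} {d : nat} {I : Type}.
Local Notation E := 'rV[R]_d.

(* S_w = S_{w_1} o ... o S_{w_n} *)
Definition word_map (S : I -> E -> E) (w : seq I) : E -> E :=
  foldr (fun i f => S i \o f) id w.

(* w|_n is the word [:: w 0; ...; w n.-1]. *)
Definition limit_set (X : set E) (S : I -> E -> E) : set E :=
  \bigcup_(w in [set: nat -> I])
    \bigcap_(n in [set n : nat | (0 < n)%N]) (word_map S (mkseq w n) @` X).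

Definition conformal_extension (e : R) (X V : set E) (f fbar : E -> E) : Prop :=
  [/\ forall x, X x -> fbar x = f x,
      C1_holder_diffeo e V fbar,
      fbar @` V `<=` V,
      forall x, V x ->
        [/\ differentiable fbar x,
            ('d fbar x : E -> E) <> (fun=> 0) &
            forall h, enorm ('d fbar x h) = opnorm ('d fbar x) * enorm h] &
      holder_diff_on e V fbar].

(* Only the values of [S i] on [X] and of [Sbar i] on [V] matter. *)
Record is_CIFS (X : set E) (S : I -> E -> E) (V : set E) (Sbar : I -> E -> E)
    : Prop := {
  cifs_dim : (0 < d)%N ;
  cifs_compact : compact X ;
  cifs_connected : connected X ;
  cifs_index_nonempty : [set: I] !=set0 ;
  cifs_index_countable : countable [set: I] ;
  cifs_maps : forall i, S i @` X `<=` X ;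
  cifs_interior_nonempty : interior X !=set0 ;
  cifs_interior_maps : forall i, S i @` interior X `<=` interior X ;
  cifs_interior_disjoint : forall i j, i <> j ->
    (S i @` interior X) `&` (S j @` interior X) = set0 ;
  cifs_cone :
    (0 < ereal_inf [set ereal_inf
             [set lebesgue_Rd (eball x r `&` interior X) * ((r ^+ d)^-1)%:E
               | r in [set r : R | (0 < r < 1)%R]]
           | x in X])%E ;
  cifs_V_open : open V ;
  cifs_V_bounded : bounded_set V ;
  cifs_V_connected : connected V ;
  cifs_X_sub_V : X `<=` V ;
  cifs_conformal : exists2 e : R, 0 < e &
    forall i, conformal_extension e X V (S i) (Sbar i) ;
  cifs_contraction : exists2 xi : R, 0 < xi < 1 &
    forall i, (ereal_sup [set (opnorm ('d (Sbar i) x))%:E | x in V] < xi%:E)%E ;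
  cifs_distortion : exists2 K : R, 0 < K &
    forall (w : seq I) (x y : E), (0 < size w)%N -> V x -> V y ->
      opnorm ('d (word_map Sbar w) y) <= K * opnorm ('d (word_map Sbar w) x)
}.

End CIFS.

(* Main.v *)
Require Import Defs.
From mathcomp Require Import all_boot all_order all_algebra.
From mathcomp Require Import all_classical all_reals all_analysis.
From mathcomp Require Import ring lra.
Import Order.TTheory GRing.Theory Num.Theory.
Import numFieldNormedType.Exports.
Local Open Scope classical_set_scope.
Local Open Scope ring_scope.

Set Implicit Arguments.
Unset Strict Implicit.
Unset Printing Implicit Defensive.

(** Put lam w = ||S_w'|| at a base point.  Conformality and bounded distortion
    make every S_w bi-Lipschitz on X with constants comparable to lam w, and
    make distinct pieces S_u(X), S_v(X) of equal generation lie at distance at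
    least a multiple of lam u from each other, because S_u(V) contains a ball of
    that radius about each point of S_u(X) and is disjoint from S_v(V).  The
    whole proof runs on these metric facts.

    Lower bound.  Replacing the point of P in S_i(X) by S_i(x) for a fixed x in F
    is a bi-Lipschitz map from P into F; and dim_H <= dim_A holds in general.

    Upper bound.  If H^s(F) = 0, then the sum of lam w ^ s over the words of any
    given length is bounded: if a finite set Q of words of length n had a large
    sum, then concatenations of words of Q would carry a Cantor set in F of
    positive H^s measure.  Hence for beta > s the sum of lam w ^ beta over all
    words is finite.  Take beta also larger than some alpha admissible for P.
    Given an r-separated subset of F, cut the coding of each point at scale r:
    beyond the last word v with lam v >= r the points look, after applying
    S_v^-1, like points of P, so at most C (lam v / r) ^ beta of them share v,
    and summing over v gives C r ^ -beta.  To localise to a ball of radius R,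
    zoom in by the longest word v with lam v >= D R; then only first letters with
    lam j <= D R matter, and the sum of lam j ^ beta over those near a given point
    is at most C R ^ beta, since the corresponding points of P are separated by
    multiples of lam j and alpha < beta. *)

(** * Euclidean and sup norms *)

Section EuclideanNorm.
Context {R : realType} {d : nat}.
Local Notation E := 'rV[R]_d.
Implicit Types (x y h : E) (L : E -> E).

Lemma enorm_ge0 x : 0 <= enorm x.
Proof. exact: sqrtr_ge0. Qed.

Lemma le_norm_enorm x : `|x| <= enorm x.
Proof.
rewrite -[`|x|]/(mx_norm x) mx_normrE; apply: bigmax_le; first exact: enorm_ge0.
move=> [i j] _ /=; rewrite !ord1 -sqrtr_sqr ler_sqrt ?sumr_ge0//; last first.
  by move=> k _; exact: sqr_ge0.
by rewrite (bigD1 j)//= lerDl sumr_ge0// => k _; exact: sqr_ge0.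
Qed.

Lemma le_enorm_norm x : enorm x <= d%:R * `|x|.
Proof.
have xi i : `|x 0 i| <= `|x|.
  rewrite -[X in _ <= X]/(mx_norm x) mx_normrE.
  exact: (le_bigmax _ (fun ij : 'I_1 * 'I_d => `|x ij.1 ij.2|) (0, i)).
rewrite -[X in _ <= X]ger0_norm ?mulr_ge0// -sqrtr_sqr ler_wsqrtr//.
have -> : (d%:R * `|x|) ^+ 2 = d%:R * \sum_(i < d) `|x| ^+ 2.
  by rewrite sumr_const card_ord exprMn expr2 -mulrA; congr (_ * _); rewrite mulr_natl.
case: (posnP d) => [d0|d0].
  by rewrite big1 ?mulr_ge0 ?sumr_ge0// => i; have := leq_trans (ltn_ord i) (eq_leq d0).
apply: (@le_trans _ _ (\sum_(i < d) `|x| ^+ 2)).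
  apply: ler_sum => i _; rewrite -real_normK ?num_real//.
  by rewrite lerXn2r ?nnegrE.
by rewrite ler_peMl ?sumr_ge0// ler1n.
Qed.

Lemma enorm0_eq0 x : enorm x = 0 -> x = 0.
Proof.
move=> x0; apply/eqP; rewrite -normr_le0.
by rewrite (le_trans (le_norm_enorm x))// x0.
Qed.

Lemma opnorm_similarity L (a : R) : (0 < d)%N -> 0 <= a ->
  (forall h, enorm (L h) = a * enorm h) -> opnorm L = a.
Proof.
move=> d0 a0 La; rewrite /opnorm.
pose e : E := delta_mx 0 (Ordinal d0).
have e1 : enorm e = 1.
  rewrite /enorm (bigD1 (Ordinal d0))//= big1.
    by rewrite addr0 !mxE !eqxx expr1n sqrtr1.
  by move=> i i0; rewrite !mxE (negbTE i0) andbF expr0n.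
have ub : ubound [set enorm (L h) | h in [set h | enorm h <= 1]] a.
  by move=> _ /= [h h1 <-]; rewrite La ler_piMr.
have ha : [set enorm (L h) | h in [set h | enorm h <= 1]] a.
  by exists e => /=; rewrite ?La e1 ?mulr1.
apply/eqP; rewrite eq_le; apply/andP; split.
  by apply: ge_sup => //; exists a.
by apply: ub_le_sup => //; exists a.
Qed.

End EuclideanNorm.

(** * Mean value inequality and lifting of segments *)

Lemma near_norm_lt {R : realType} {W : normedModType R} (p : W) (e : R) :
  0 < e -> \forall q \near p, `|p - q| < e.
Proof. by move=> e0; apply/nbhs_normP; exists e. Qed.

Section MeanValue.
Context {R : realType} {d : nat}.
Local Notation E := 'rV[R]_d.

(** In the sup norm it is enough to bound each coordinate, and along the segment each coordinate is
    a real function with a one-variable mean value theorem. *)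
Lemma mean_value_norm (f : E -> E) (x v : E) (M : R) :
  (forall t : R, 0 <= t <= 1 -> differentiable f (x + t *: v)) ->
  (forall t : R, 0 <= t <= 1 -> `|'d f (x + t *: v) v| <= M) ->
  `|f (x + v) - f x| <= M.
Proof.
move=> df dfM.
have M0 : 0 <= M by apply: le_trans (dfM 0 _); rewrite ?normr_ge0 ?lexx ?ler01.
rewrite -[`|_|]/(mx_norm _) mx_normrE; apply: bigmax_le => // -[i j] _ /=.
pose phi (t : R) : R := (f (x + t *: v)) i j.
have dphi (t : R) : 0 <= t <= 1 -> is_derive t 1 phi ('d f (x + t *: v) v i j).
  move=> t01; have dft := df _ t01.
  have q : (fun h : R => h^-1 *: (phi (h *: 1 + t) - phi t)) @ 0^' -->
      'd f (x + t *: v) v i j.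
    rewrite (_ : (fun h : R => _) = (fun N : E => N i j) \o
        (fun h : R => h^-1 *: (f (h *: v + (x + t *: v)) - f (x + t *: v)))).
      apply: (@cvg_comp _ _ _ _ _ _ (nbhs ('d f (x + t *: v) v))).
        by rewrite -deriveE//; exact: diff_derivable.
      exact: coord_continuous.
    apply/funext => h /=; rewrite !mxE /phi; congr (_ * (f _ i j - _)).
    by rewrite [h *: 1]mulr1 scalerDl addrCA.
  by split; [apply/cvg_ex; eexists; exact: q|exact: cvg_lim q].
have [c c01 ] : exists2 c, c \in `[0, 1]%R &
    phi 1 - phi 0 = 'd f (x + c *: v) v i j * (1 - 0).
  apply: MVT_segment => //.
    move=> t; rewrite in_itv/= => /andP[t0 t1].
    by apply: dphi; rewrite !ltW.
  apply: derivable_within_continuous => t; rewrite in_itv/= => t01.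
  by have [] := dphi _ t01.
rewrite /phi scale1r scale0r addr0 subr0 mulr1 => e.
rewrite !mxE e; apply: le_trans (dfM c _); last by rewrite in_itv in c01.
rewrite -[X in _ <= X]/(mx_norm _) mx_normrE.
exact: (le_bigmax _ (fun ij : 'I_1 * 'I_d => `|_ ij.1 ij.2|) (i, j)).
Qed.
End MeanValue.

Lemma differentiable_near_lipschitz {R : realType} {U W : normedModType R}
    (G : U -> W) (p : U) (A : R) :
  0 < A -> differentiable G p -> (forall h, `|'d G p h| <= A * `|h|) ->
  \forall y \near p, `|G y - G p| <= 2 * A * `|y - p|.
Proof.
move=> A0 /diff_locally/eqaddoP dG GA.
have := dG _ A0; rewrite near_simpl (near_shift p) /=; apply: filterS => y /=.
rewrite !fctE /= sub0r subrK => H.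
have -> : G y - G p = (G y - (G p + 'd G p (y - p))) + 'd G p (y - p).
  by rewrite opprD addrA addrNK.
rewrite (le_trans (ler_normD _ _))// -mulrA mulr_natl mulr2n lerD//.
Qed.

Section SegmentLifting.
Context {R : realType} {d : nat}.
Local Notation E := 'rV[R]_d.
Variables (T G : E -> E) (V : set E) (A delta : R) (x v : E).
Hypotheses (oT : open (T @` V)) (GK : forall z, V z -> G (T z) = z)
  (cT : forall z, V z -> {for z, continuous T})
  (lG : forall z, V z -> \forall y \near T z, `|G y - G (T z)| <= A * `|y - T z|)
  (A0 : 0 < A) (Vx : forall z, `|z - x| <= delta -> V z)
  (vd : A * `|v| <= delta).

(* The largest parameter t in [0, 1] whose point has a preimage that has moved
   at speed at most A from x cannot be smaller than 1. *)
Lemma lift_segment : exists z, [/\ V z, T z = T x + v & `|z - x| <= A * `|v|].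
Proof.
pose Z (t : R) := 0 <= t <= 1 /\
  exists z, `|z - x| <= A * `|v| * t /\ T z = T x + t *: v.
have Z0 : Z 0.
  split; first by rewrite lexx ler01.
  by exists x; rewrite subrr normr0 mulr0 scale0r addr0.
have ubZ : ubound Z 1 by move=> t [/andP[]].
have hZ : has_sup Z by split; [exists 0|exists 1].
set s := sup Z.
have s01 : 0 <= s <= 1.
  by rewrite ub_le_sup//=; [apply: ge_sup => //; exists 0|case: hZ].
have Av0 : 0 <= A * `|v| by rewrite mulr_ge0// ltW.
have inV t z : 0 <= t <= 1 -> `|z - x| <= A * `|v| * t -> `|z - x| <= delta.
  move=> /andP[t0 t1] zx; rewrite (le_trans zx)// (le_trans _ vd)//.
  by rewrite ler_piMr.
(* The supremum is attained: otherwise every [z] of the compact ball fails on a neighbourhood of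
   [(z, s)], and compactness clears a whole neighbourhood of [s] of parameters in [Z]. *)
have Zs : Z s.
  split=> //; apply: contrapT => /forallNP Ns.
  have Kc : compact [set z : E | `|z - x| <= delta].
    apply: bounded_closed_compact.
      exists (`|x| + delta); split; first exact: num_real.
      move=> M xM z /= zx; rewrite (le_trans _ (ltW xM))//.
      by rewrite -[z](subrK x) (le_trans (ler_normD _ _))// addrC lerD2l.
    rewrite (_ : [set _ | _] = (fun z => `|z - x|) @^-1` [set r | r <= delta])//.
    apply: closed_comp; last exact: closed_le.
    move=> z _.
    have h : (fun z : E => z - x) q @[q --> z] --> z - x.
      apply: (@cvgB _ E E (nbhs z) _ id (cst x)); [exact: cvg_id|exact: cvg_cst].
    exact: (cvg_norm h).
  have /compact_near_coveringP/(_ R (nbhs s)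
    (fun t z => ~ (`|z - x| <= A * `|v| * t /\ T z = T x + t *: v))) := Kc.
  have cont z : `|z - x| <= delta ->
      \forall z' \near z & t \near s,
        ~ (`|z' - x| <= A * `|v| * t /\ T z' = T x + t *: v).
    move=> zx; have /not_andP[/negP|neq] := Ns z.
      rewrite -ltNge => lt.
      pose g := (`|z - x| - A * `|v| * s) / 2.
      have g0 : 0 < g by rewrite divr_gt0// subr_gt0.
      have Av1 : 0 < A * `|v| + 1 by rewrite ltr_wpDl.
      near=> z' t => -[z'x _].
      have h1 : `|z - z'| < g by near: z'; exact: (@near_norm_lt R E _ _ g0).
      have h2 : A * `|v| * (t - s) < g.
        have : `|s - t| < g / (A * `|v| + 1).
          by near: t; exact: (@near_norm_lt R R^o _ _ (divr_gt0 g0 Av1)).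
        rewrite ltr_pdivlMr// => /(le_lt_trans _); apply.
        rewrite mulrC distrC (le_trans (ler_wpM2r Av0 (ler_norm _)))//.
        by rewrite ler_wpM2l// lerDl.
      have h3 := ler_distD z' z x.
      rewrite mulrBr in h2; move: z'x h1 h2 h3; rewrite /g.
      by move: (A * _ * t) (A * _ * s) => a b; lra.
    pose g := `|T z - (T x + s *: v)| / 2.
    have g0 : 0 < g by rewrite divr_gt0// normr_gt0 subr_eq0; apply/eqP.
    have v1 : 0 < `|v| + 1 by rewrite ltr_wpDl.
    have cTz : \forall q \near z, `|T z - T q| < g.
      by have /cT/(_ _ (@near_norm_lt R E _ _ g0)) := Vx zx.
    near=> z' t => -[_ Tz'].
    have h1 : `|T z - T z'| < g.
      by near: z'; exact: cTz.
    have h2 : `|t *: v - s *: v| < g.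
      have : `|s - t| < g / (`|v| + 1).
        by near: t; exact: (@near_norm_lt R R^o _ _ (divr_gt0 g0 v1)).
      rewrite ltr_pdivlMr// => /(le_lt_trans _); apply.
      by rewrite -scalerBl normrZ distrC ler_wpM2l// lerDl.
    have : `|T z - (T x + s *: v)| < g + g.
      rewrite (_ : T z - _ = (T z - T z') + (t *: v - s *: v)).
        by rewrite (le_lt_trans (ler_normD _ _))// ltrD.
      by rewrite Tz' opprD addrA opprD !addrA addrAC addrNK addrAC.
    by rewrite -splitr ltxx.
  move=> /(_ _ cont); rewrite near_simpl => /nbhs_ballP [e /= e0 he].
  have [t Zt st] := sup_adherent e0 hZ.
  have ts : t <= s by apply: ub_le_sup => //; case: hZ.
  have bst : ball s e t.
    by rewrite /ball /= ger0_norm ?subr_ge0// ltrBlDr -ltrBlDl.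
  case: (Zt) => t01 [z [zx Tz]].
  by apply: (he t bst z) => //=; exact: inV zx.
have [_ [z [zx Tz]]] := Zs.
have Vz : V z by apply: Vx; exact: inV zx.
have := s01 => /andP[s0]; rewrite le_eqVlt => /orP[/eqP s1|s1].
  by exists z; split=> //; [rewrite Tz s1 scale1r|move: zx; rewrite s1 mulr1].
exfalso.
(* If [s < 1], openness of the image of [V] gives a preimage of a slightly later point, and the
   local Lipschitz bound of [G] at [T z] keeps it within the allowed speed. *)
have near1 : \forall t \near s^'+, (T @` V) (T x + t *: v) /\
    `|G (T x + t *: v) - G (T z)| <= A * `|(T x + t *: v) - T z|.
  have : \forall t \near s, (T @` V) (T x + t *: v) /\
    `|G (T x + t *: v) - G (T z)| <= A * `|(T x + t *: v) - T z|.
    have c : (fun t : R => T x + t *: v) t @[t --> s] --> T z.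
      by rewrite Tz; apply: cvgD; [exact: cvg_cst|apply: cvgZr_tmp; exact: cvg_id].
    apply: (c (fun y => (T @` V) y /\ `|G y - G (T z)| <= A * `|y - T z|)).
    apply: filterI; last exact: lG.
    by apply: open_nbhs_nbhs; split => //; exists z.
  exact: cvg_within.
have [t [st t1 [[z' Vz' Tz'] Gt]]] : exists t,
    [/\ s < t, t <= 1 & (T @` V) (T x + t *: v) /\
    `|G (T x + t *: v) - G (T z)| <= A * `|(T x + t *: v) - T z|].
  near s^'+ => t; exists t; split.
  - by near: t; exact: nbhs_right_gt.
  - by near: t; exact: nbhs_right_le.
  - by near: t; exact: near1.
have : t <= s.
  apply: ub_le_sup; first by case: hZ.
  split; first by rewrite t1 (le_trans s0 (ltW st)).
  exists z'; split=> //.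
  rewrite -Tz' !GK// in Gt.
  have -> : z' - x = (z' - z) + (z - x) by rewrite addrA subrK.
  rewrite (le_trans (ler_normD _ _))// (le_trans (lerD Gt zx))//.
  rewrite Tz' Tz opprD addrACA subrr add0r -scalerBl normrZ ger0_norm; last first.
    by rewrite subr_ge0 ltW.
  by rewrite [_ * `|v|]mulrC mulrA -mulrDr subrK.
by rewrite leNgt st.
Unshelve. all: by end_near. Qed.
End SegmentLifting.

(** * Metric estimates for words of a CIFS *)

Lemma word_map_cat (I : Type) (R : realType) (d : nat)
    (S : I -> 'rV[R]_d -> 'rV[R]_d) (u v : seq I) x :
  word_map S (u ++ v) x = word_map S u (word_map S v x).
Proof. by elim: u => //= i u IH; rewrite IH. Qed.

Lemma diff_compE {R : realType} {U V W : normedModType R} (f : U -> V) (g : V -> W) x h :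
  differentiable f x -> differentiable g (f x) ->
  'd (g \o f) x h = 'd g (f x) ('d f x h).
Proof. by move=> df dg; move/(congr1 (@^~ h)) : (diff_comp df dg). Qed.

Section WordMaps.
Context {R : realType} {d : nat} {I : Type}.
Local Notation E := 'rV[R]_d.
Context {X : set E} {S : I -> E -> E} {V : set E} {Sbar : I -> E -> E}.
Hypothesis hS : is_CIFS X S V Sbar.
Local Notation T := (word_map Sbar).
Local Notation dnorm w x := (opnorm ('d (T w) x)).

Lemma conformal_letter i x : V x ->
  [/\ V (Sbar i x), differentiable (Sbar i) x, 0 < opnorm ('d (Sbar i) x) &
    forall h, enorm ('d (Sbar i) x h) = opnorm ('d (Sbar i) x) * enorm h].
Proof.
move=> Vx; have [e e0 /(_ i) [_ _ VV /(_ x Vx) [dx dn0 sim] _]] := cifs_conformal hS.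
split => //; first by apply: VV; exists x.
rewrite lt_neqAle; apply/andP; split; last first.
  pose h : E := delta_mx 0 (Ordinal (cifs_dim hS)).
  have h0 : 0 < enorm h.
    rewrite lt_neqAle enorm_ge0 andbT eq_sym; apply/eqP => /enorm0_eq0 /matrixP.
    move=> /(_ 0 (Ordinal (cifs_dim hS))); rewrite !mxE !eqxx /= => /eqP.
    by rewrite oner_eq0.
  by rewrite -(pmulr_lge0 _ h0) -sim enorm_ge0.
apply/eqP => z; apply: dn0; apply/funext => h.
by apply: enorm0_eq0; rewrite sim -z mul0r.
Qed.

Lemma conformal_word w x : V x ->
  [/\ V (T w x), differentiable (T w) x, 0 < dnorm w x &
    forall h, enorm ('d (T w) x h) = dnorm w x * enorm h].
Proof.
move=> Vx; elim: w => [|i w [VT dT T0 simT]].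
  have d1 h : enorm ('d id x h) = 1 * enorm h by rewrite diff_val mul1r.
  have o1 := opnorm_similarity (cifs_dim hS) ler01 d1.
  split => //; first by rewrite o1.
  by move=> h; rewrite o1.
have [VS dS S0 simS] := conformal_letter i VT.
have eT : T (i :: w) = Sbar i \o T w by [].
have sim h : enorm ('d (T (i :: w)) x h) =
    opnorm ('d (Sbar i) (T w x)) * dnorm w x * enorm h.
  by rewrite eT (diff_compE _ dT dS) simS simT mulrA.
have o : dnorm (i :: w) x = opnorm ('d (Sbar i) (T w x)) * dnorm w x.
  exact: (opnorm_similarity (cifs_dim hS) (ltW (mulr_gt0 S0 T0)) sim).
split; first exact: VS.
- by rewrite eT; exact: (differentiable_comp dT dS).
- rewrite o; exact: (mulr_gt0 S0 T0).
- move=> h; rewrite o; exact: sim.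
Qed.

Lemma dnorm_nil x : V x -> dnorm [::] x = 1.
Proof.
by move=> Vx; apply: (opnorm_similarity (cifs_dim hS)) => // h; rewrite diff_val mul1r.
Qed.

(** Ratios of similarities multiply exactly, so the chain rule gives an equality where general
    operator norms give only an inequality. *)
Lemma dnorm_cat u v x : V x -> dnorm (u ++ v) x = dnorm u (T v x) * dnorm v x.
Proof.
move=> Vx; have [VT dT T0 simT] := conformal_word v Vx.
have [VU dU U0 simU] := conformal_word u VT.
apply: (opnorm_similarity (cifs_dim hS)).
  exact: (mulr_ge0 (ltW U0) (ltW T0)).
move=> h; rewrite (_ : T (u ++ v) = T u \o T v).
  by rewrite (diff_compE _ dT dU) simU simT mulrA.
by apply/funext => y; rewrite /= word_map_cat.
Qed.

Lemma dnorm_decay : exists2 xi : R, 0 < xi < 1 &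
  forall w x, V x -> dnorm w x <= xi ^+ size w.
Proof.
have [xi xi01 hxi] := cifs_contraction hS; exists xi => // w x Vx.
elim: w => [|i w IH]; first by rewrite dnorm_nil.
have [VT _ T0 _] := conformal_word w Vx.
rewrite (dnorm_cat [:: i] w Vx : dnorm (i :: w) x = _) exprS; apply: ler_pM.
- by have [_ _ z _] := conformal_word [:: i] VT; exact: (ltW z).
- exact: (ltW T0).
- rewrite -lee_fin; apply: le_trans (ltW (hxi i)).
  by apply: ereal_sup_ubound; exists (T w x).
- exact: IH.
Qed.

Lemma dnorm_distortion : exists2 K : R, 1 <= K &
  forall w x y, V x -> V y -> dnorm w y <= K * dnorm w x.
Proof.
(* The distortion hypothesis concerns non-empty words; the maximum with 1 covers the empty word,
   whose derivative has norm 1. *)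
have [K K0 hK] := cifs_distortion hS; exists (Num.max 1 K).
  by rewrite le_max lexx.
move=> [|i w] x y Vx Vy.
  by rewrite [X in X <= _](dnorm_nil Vy) [X in _ * X](dnorm_nil Vx) mulr1 le_max lexx.
apply: (le_trans (hK (i :: w) x y isT Vx Vy)).
have [_ _ z _] := conformal_word (i :: w) Vx.
apply: ler_wpM2r; first exact: (ltW z).
by rewrite le_max lexx orbT.
Qed.

(** Inverse branches of letters compose. The image of [V] under [i :: w] is the part of the open
    image of [Sbar i] that the continuous inverse [g] sends into the image of [w], hence open. *)
Lemma word_map_inverse w : open (T w @` V) /\
  exists G : E -> E, forall x, V x ->
    [/\ G (T w x) = x & differentiable G (T w x)].
Proof.
elim: w => [|i w [oT [G hG]]] /=.
  split; first by rewrite image_id; exact: cifs_V_open hS.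
  by exists id => x Vx.
have [e e0 /(_ i) [_ [_ oS _ [g gK [dg _]]] VV _ _]] := cifs_conformal hS.
have VT x : V x -> V (T w x) by move=> Vx; have [] := conformal_word w Vx.
split.
  have -> : (Sbar i \o T w) @` V = (Sbar i @` V) `&` g @^-1` (T w @` V).
    apply/seteqP; split=> [_ [x Vx <-]|y [[z Vz <-]]] /=.
      by rewrite gK; [split; [exists (T w x); auto|exists x]|auto].
    by rewrite gK// => -[x Vx <-]; exists x.
  rewrite openE => y [Sy Tgy].
  apply: filterI; first exact: open_nbhs_nbhs.
  apply: (differentiable_continuous (dg _ Sy)).
  exact: open_nbhs_nbhs.
exists (G \o g) => x Vx; have [GT dG] := hG _ Vx.
have gT := gK _ (VT _ Vx).
split; first by rewrite /= gT.
apply: differentiable_comp; first by apply: dg; exists (T w x); auto.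
by rewrite /= gT.
Qed.

Lemma word_map_inj w x y : V x -> V y -> T w x = T w y -> x = y.
Proof.
have [_ [G hG]] := word_map_inverse w.
by move=> /hG [Gx _] /hG [Gy _] e; rewrite -Gx e Gy.
Qed.

(** Disjoint images of [V] force equal first letters; injectivity cancels them and the argument
    recurses on the tails. *)
Lemma word_map_disjoint (hV : forall i j : I, i <> j ->
    (Sbar i @` V) `&` (Sbar j @` V) = set0) u v x y :
  size u = size v -> V x -> V y -> T u x = T v y -> u = v.
Proof.
move=> + Vx Vy; elim: u v => [|i u IH] [|j v] //= [suv] e.
have Vu : V (T u x) by have [] := conformal_word u Vx.
have Vv : V (T v y) by have [] := conformal_word v Vy.
have ij : i = j.
  apply: contrapT => /hV; apply/eqP/set0P; exists (Sbar i (T u x)).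
  by split; [exists (T u x)|rewrite e; exists (T v y)].
move: e; rewrite -ij => /(@word_map_inj [:: i]) uv.
by rewrite (IH v)//; exact: uv.
Qed.
End WordMaps.

(** The interface between the analytic and the combinatorial half: sup-norm estimates for [S]
    itself, free of derivatives, with one constant [D] for every inequality. Disjointness of the
    images of [V] survives as [cb_sep]. *)
Record conformal_bounds {R : realType} {d : nat} {I : Type} (X : set 'rV[R]_d)
    (S : I -> 'rV[R]_d -> 'rV[R]_d) (lam : seq I -> R) (D xi : R) : Prop := {
  cb_D_ge1 : 1 <= D ;
  cb_xi : 0 < xi < 1 ;
  cb_compact : compact X ;
  cb_nonempty : X !=set0 ;
  cb_index : [set: I] !=set0 ;
  cb_maps : forall w x, X x -> X (word_map S w x) ;
  cb_diam : forall x y, X x -> X y -> `|x - y| <= D ;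
  cb_lam_nil : lam [::] = 1 ;
  cb_lam_gt0 : forall w, 0 < lam w ;
  cb_lam_cat_le : forall u v, lam (u ++ v) <= D * (lam u * lam v) ;
  cb_lam_cat_ge : forall u v, lam u * lam v <= D * lam (u ++ v) ;
  cb_lam_decay : forall w, lam w <= xi ^+ size w ;
  cb_lip : forall w x y, X x -> X y ->
    `|word_map S w x - word_map S w y| <= D * (lam w * `|x - y|) ;
  cb_colip : forall w x y, X x -> X y ->
    lam w * `|x - y| <= D * `|word_map S w x - word_map S w y| ;
  cb_sep : forall u v x y, size u = size v -> u <> v -> X x -> X y ->
    lam u <= D * `|word_map S u x - word_map S v y|
}.

Section Oscillation.
Context {R : realType} {d : nat}.
Local Notation E := 'rV[R]_d.

(* Connectedness chains the estimate, available at scale delta, through X;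
   compactness makes the number of links uniform. *)
Lemma connected_oscillation (X : set E) (x0 : E) (J : Type) (f : J -> E -> E)
    (a : J -> R) (delta : R) :
  compact X -> connected X -> X x0 -> 0 < delta -> (forall j, 0 <= a j) ->
  (forall j x y, X x -> `|y - x| < delta -> `|f j y - f j x| <= a j) ->
  exists2 C : R, 0 < C & forall j x, X x -> `|f j x - f j x0| <= C * a j.
Proof.
move=> cX conX Xx0 d0 a0 loc.
pose A := [set x | X x /\ exists C : R, forall j, `|f j x - f j x0| <= C * a j].
have open_union (B : set E) : open [set z | exists2 x, B x & `|z - x| < delta].
  rewrite openE => z [x Bx zx].
  have e0 : 0 < delta - `|z - x| by rewrite subr_gt0.
  apply: filterS (@near_norm_lt R E z _ e0) => q zq; exists x => //.
  rewrite (le_lt_trans (ler_distD z _ _))// -ltrBrDr.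
  by rewrite distrC.
have step x y C : X x -> `|y - x| < delta ->
    (forall j, `|f j x - f j x0| <= C * a j) ->
    (forall j, `|f j y - f j x0| <= (C + 1) * a j).
  move=> Xx yx hC j; rewrite (le_trans (ler_distD (f j x) _ _))// addrC mulrDl mul1r.
  by rewrite lerD// loc.
(* [A] is non-empty and relatively open and closed in [X], because a step shorter than [delta] costs
   only 1 in the constant. *)
have AX : A = X.
  apply: conX.
  - by exists x0; split=> //; exists 0 => j; rewrite subrr normr0 mul0r.
  - exists [set z | exists2 x, A x & `|z - x| < delta]; first exact: open_union.
    apply/seteqP; split=> [x Ax|x [Xx [y [Xy [C hC]] xy]]].
      by split; [case: Ax|exists x => //; rewrite subrr normr0].
    by split=> //; exists (C + 1); exact: step hC.
  - exists (~` [set z | exists2 x, (X `\` A) x & `|z - x| < delta]).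
      exact/open_closedC/open_union.
    apply/seteqP; split=> [x Ax|x [Xx nx]].
      split; first by case: Ax.
      case=> y [Xy nAy] xy; apply: nAy; split=> //.
      case: Ax => Xx [C hC]; exists (C + 1); apply: step hC => //.
      by rewrite distrC.
    by apply: contrapT => nAx; apply: nx; exists x => //; rewrite subrr normr0.
(* Near a point with constant [C] the constant [C + 1] works; compactness merges these local
   constants into one. *)
have H : \forall C \near (+oo : set_system R),
    X `<=` (fun x => forall j, `|f j x - f j x0| <= C * a j).
  apply: (proj1 (compact_near_coveringP X) cX R +oo
    (fun C x => forall j, `|f j x - f j x0| <= C * a j)) => x.
  rewrite -{1}AX => -[Xx [C hC]].
  have nx := @near_norm_lt R E x _ d0.
  near=> y C' => j; apply: (@le_trans _ _ ((C + 1) * a j)).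
    have xy : `|x - y| < delta by near: y.
    by apply: (step x) => //; rewrite distrC.
  have CC' : C + 1 <= C' by near: C'; apply: nbhs_pinfty_ge; exact: num_real.
  exact: ler_wpM2r.
have [C [C0 hC]] : exists C : R, 0 < C /\
   X `<=` (fun x => forall j, `|f j x - f j x0| <= C * a j).
  near (+oo : set_system R) => C; exists C; split.
    by near: C; apply: nbhs_pinfty_gt; exact: num_real.
  by near: C.
by exists C => // j x Xx; exact: hC.
Unshelve. all: by end_near. Qed.

End Oscillation.

(** * From derivative bounds to metric bounds *)

Section MetricBounds.
Context {R : realType} {d : nat} {I : Type}.
Local Notation E := 'rV[R]_d.
Context {X : set E} {S : I -> E -> E} {V : set E} {Sbar : I -> E -> E}.
Hypothesis hS : is_CIFS X S V Sbar.
Local Notation T := (word_map Sbar).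
Local Notation dnorm w x := (opnorm ('d (T w) x)).

Lemma word_map_extension w x : X x ->
  word_map S w x = T w x /\ X (word_map S w x).
Proof.
move=> Xx; elim: w => //= i w [e XT]; split; last first.
  by apply: (cifs_maps hS (i := i)); exists (word_map S w x).
have [e0 _ /(_ i) [SX _ _ _ _]] := cifs_conformal hS.
by rewrite -e SX.
Qed.

Lemma compact_margin : exists2 delta : R, 0 < delta &
  forall x z, X x -> `|z - x| <= delta -> V z.
Proof.
have H : \forall delta \near (0 : R)^'+,
    X `<=` (fun x => forall z, `|z - x| <= delta -> V z).
  apply: (proj1 (compact_near_coveringP X) (cifs_compact hS) R 0^'+
    (fun delta x => forall z, `|z - x| <= delta -> V z)) => x Xx.
  have : nbhs x V.
    apply: open_nbhs_nbhs; split; first exact: cifs_V_open hS.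
    exact: (cifs_X_sub_V hS).
  move=> /nbhs_normP [e /= e0 eV]; have e2 : 0 < e / 2 by rewrite divr_gt0.
  have nx : \forall y \near x, `|x - y| < e / 2 by apply/nbhs_normP; exists (e / 2).
  near=> x' delta => z zx'.
  apply: eV => /=; rewrite (le_lt_trans (ler_distD x' _ _))// [e]splitr.
  have h1 : `|x - x'| < e / 2 by near: x'.
  have h2 : delta <= e / 2 by near: delta; exact: nbhs_right_le.
  by rewrite ltr_leD// distrC (le_trans zx').
have [delta [d0 hd]] : exists delta : R, 0 < delta /\
   X `<=` (fun x => forall z, `|z - x| <= delta -> V z).
  near (0 : R)^'+ => delta; exists delta; split.
    by near: delta; exact: nbhs_right_gt.
  by near: delta.
by exists delta => // x z Xx; exact: hd.
Unshelve. all: by end_near. Qed.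

Lemma word_map_local_lipschitz w x v (M : R) :
  (forall t : R, 0 <= t <= 1 -> V (x + t *: v)) ->
  (forall y, V y -> dnorm w y <= M) ->
  `|T w (x + v) - T w x| <= M * d%:R * `|v|.
Proof.
move=> Vs dM; apply: mean_value_norm => t /Vs Vt.
  by have [_ ? _ _] := conformal_word hS w Vt.
have [_ _ _ sim] := conformal_word hS w Vt.
apply: (le_trans (le_norm_enorm _)); rewrite sim -mulrA.
apply: ler_pM; [| |exact: dM|exact: le_enorm_norm].
  by have [_ _ /ltW ? _] := conformal_word hS w Vt.
exact: enorm_ge0.
Qed.

(** By conformality the differential of the inverse branch has sup-norm at most [d / m]. Twice that
    is a local Lipschitz constant, which [lift_segment] turns into control over a whole segment. *)
Lemma word_map_lift w x v (m delta : R) : V x -> 0 < m ->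
  (forall y, V y -> m <= dnorm w y) ->
  (forall z, `|z - x| <= delta -> V z) ->
  2 * (d%:R / m) * `|v| <= delta ->
  exists z, [/\ V z, T w z = T w x + v & `|z - x| <= 2 * (d%:R / m) * `|v| ].
Proof.
move=> Vx m0 dm xV vd.
have [oT [G hG]] := word_map_inverse hS w.
have dd : 0 < d%:R :> R by rewrite ltr0n (cifs_dim hS).
apply: (@lift_segment _ _ (T w) G V (2 * (d%:R / m)) delta) => //.
- by move=> z /hG [].
- by move=> z Vz; have [_ /differentiable_continuous ? _ _] := conformal_word hS w Vz.
- move=> z Vz; have [GT dG] := hG _ Vz.
  apply: differentiable_near_lipschitz => //; first by rewrite divr_gt0.
  move=> h; have [_ dT _ sim] := conformal_word hS w Vz.
  (* On the open image of [V], [T w] after [G] is the identity, and so is its differential. *)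
  have e : 'd (T w) z ('d G (T w z) h) = h.
    have dT' : differentiable (T w) (G (T w z)) by rewrite GT.
    have := diff_compE h dG dT'; rewrite [in X in _ = X]GT => <-.
    rewrite -deriveE; last exact: differentiable_comp.
    rewrite (@near_eq_derive _ _ _ _ id); first by rewrite derive_id.
    have := open_nbhs_nbhs (conj oT (ex_intro2 _ _ z Vz erefl)).
    by apply: filterS => y [y' Vy' <-] /=; have [-> _] := hG _ Vy'.
  apply: (le_trans (le_norm_enorm _)).
  have := le_enorm_norm h; rewrite -[in X in X <= _]e sim => le.
  rewrite mulrAC ler_pdivlMr// mulrC (le_trans _ le)//.
  by rewrite ler_wpM2r ?enorm_ge0// dm.
- by rewrite mulr_gt0// divr_gt0.
Qed.

(** [lam w] is the derivative norm at a fixed point of [X], representative of all of [V] by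
    distortion. Upper bounds come from the mean value inequality, chained through [X] by
    connectedness. Lower bounds come from lifting: a point too close to [T w x] has a preimage in
    [V], on which injectivity or disjointness of images bears. *)
Lemma CIFS_conformal_bounds
    (hV : forall i j : I, i <> j -> (Sbar i @` V) `&` (Sbar j @` V) = set0) :
  exists lam D xi, conformal_bounds X S lam D xi.
Proof.
have [x0 Xx0] : X !=set0.
  by have [x /interior_subset Xx] := cifs_interior_nonempty hS; exists x.
have XV := cifs_X_sub_V hS.
have [xi xi01 decay] := dnorm_decay hS.
have [K K1 dist] := dnorm_distortion hS.
have K0 : 0 < K by exact: lt_le_trans K1.
have [delta d0 margin] := compact_margin.
have [lam lamE] : exists lam : seq I -> R, forall w, lam w = dnorm w x0.
  by exists (fun w => dnorm w x0).
have lam0 w : 0 < lam w.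
  by rewrite lamE; have [_ _ ? _] := conformal_word hS w (XV _ Xx0).
have lamU w y : V y -> dnorm w y <= K * lam w.
  by rewrite lamE; apply: dist; exact: XV.
have lamL w y : V y -> lam w / K <= dnorm w y.
  by move=> Vy; rewrite ler_pdivrMr// mulrC lamE; apply: dist => //; exact: XV.
have dd : 0 < d%:R :> R by rewrite ltr0n (cifs_dim hS).
pose M := K * d%:R.
have M0 : 0 < M by rewrite mulr_gt0.
have loc w x y : X x -> `|y - x| < delta -> `|T w y - T w x| <= M * (lam w * `|y - x|).
  move=> Xx yx; have -> : y = x + (y - x) by rewrite addrC subrK.
  rewrite (addrC x (y - x)) addrK (addrC _ x).
  apply: (le_trans (word_map_local_lipschitz (M := K * lam w) _ _)).
  - move=> t /andP[t0 t1]; apply: (margin x) => //.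
    rewrite addrC addKr normrZ ger0_norm// (le_trans _ (ltW yx))//.
    by rewrite ler_piMl.
  - by move=> z Vz; exact: lamU.
  - by rewrite /M !mulrA [K * _ * lam w]mulrAC lexx.
have [C C0 osc] : exists2 C : R, 0 < C & forall w x, X x ->
    `|T w x - T w x0| <= C * (M * (lam w * delta)).
  apply: (@connected_oscillation R d X x0 (seq I) (fun w => T w)
     (fun w => M * (lam w * delta)) delta) => //.
  - exact: cifs_compact hS.
  - exact: cifs_connected hS.
  - by move=> w; rewrite mulr_ge0 ?mulr_ge0// ltW.
  - move=> w x y Xx yx; rewrite (le_trans (loc _ _ _ Xx yx))//.
    by rewrite ler_wpM2l ?(ltW M0)// ler_wpM2l ?(ltW (lam0 w))// ltW.
have [B [B0 hB]] : exists B : R, 0 < B /\ forall x y, X x -> X y -> `|x - y| <= B.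
  have [B [_ hB]] := compact_bounded (cifs_compact hS).
  exists (2 * (`|B| + 1)); split; first by rewrite mulr_gt0// ltr_wpDl.
  move=> x y Xx Xy; rewrite (le_trans (ler_normB _ _))// mulr_natl mulr2n lerD//.
    by apply: hB => //; rewrite (le_lt_trans (ler_norm _))// ltrDl.
  by apply: hB => //; rewrite (le_lt_trans (ler_norm _))// ltrDl.
have Tx w x : X x -> T w x = word_map S w x by move=> /(word_map_extension w)[].
(* [M] serves pairs closer than [delta]. For other pairs [delta] is at most their distance, and
   passing through [x0] costs the oscillation bound twice. *)
pose L := M + 2 * C * M.
have lip w x y : X x -> X y -> `|T w x - T w y| <= L * (lam w * `|x - y|).
  move=> Xx Xy; have [xy|yx] := ltP `|x - y| delta.
    rewrite (le_trans (loc _ _ _ Xy xy))// ler_wpM2r//.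
      by rewrite mulr_ge0// ltW.
    by rewrite lerDl !mulr_ge0// ltW.
  have l1 : lam w * delta <= lam w * `|x - y| by rewrite ler_wpM2l// ltW.
  apply: (@le_trans _ _ ((2 * C * M) * (lam w * `|x - y|))); last first.
    by rewrite ler_wpM2r// ?lerDr ?(ltW M0)// mulr_ge0// ltW.
  apply: (@le_trans _ _ ((2 * C * M) * (lam w * delta))); last first.
    by rewrite ler_wpM2l// !mulr_ge0// ltW.
  have h1 := osc w x Xx; have h2 := osc w y Xy.
  rewrite distrC in h2; have h3 := ler_distD (T w x0) (T w x) (T w y).
  have -> : 2 * C * M * (lam w * delta) =
      C * (M * (lam w * delta)) + C * (M * (lam w * delta)) by ring.
  exact: (le_trans h3 (lerD h1 h2)).
(* This is [lam w] times the constant [2 * (d / m)] of [word_map_lift] at [m = lam w / K]. *)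
pose a := 2 * (d%:R * K).
have a0 : 0 < a by rewrite !mulr_gt0.
have lift w x v : X x -> a * `|v| <= lam w * delta ->
    exists z, [/\ V z, T w z = T w x + v & lam w * `|z - x| <= a * `|v|].
  have e : 2 * (d%:R / (lam w / K)) = a / lam w.
    by rewrite /a invf_div !mulrA.
  move=> Xx vd.
  have [||||z [Vz Tz zx]] := @word_map_lift w x v (lam w / K) delta (XV _ Xx).
  - by rewrite divr_gt0.
  - by move=> y Vy; exact: lamL.
  - by move=> z; exact: margin.
  - by rewrite e mulrAC ler_pdivrMr// mulrC [delta * _]mulrC mulrC.
  exists z; split => //.
  by move: zx; rewrite e mulrAC ler_pdivlMr// mulrC.
have ad0 : 0 < a / delta by rewrite divr_gt0.
(* The sum of all constants in play, so that [DL] can replace any of them by [D]. *)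
pose D := 1 + B + K + L + a + a / delta * B + a / delta.
have L0 : 0 < L by rewrite addr_gt0// !mulr_gt0.
have adB0 : 0 < a / delta * B by rewrite mulr_gt0.
have DL c x y : c <= D -> 0 <= y -> x <= c * y -> x <= D * y.
  by move=> cD y0 xy; rewrite (le_trans xy)// ler_wpM2r.
have lam_cat u v : lam (u ++ v) = dnorm u (T v x0) * lam v.
  rewrite !lamE; exact: (dnorm_cat hS u v (XV _ Xx0)).
have VT v : V (T v x0) by have [] := conformal_word hS v (XV _ Xx0).
have LamM0 u v : 0 <= lam u * lam v by rewrite mulr_ge0// ltW.
exists lam, D, xi; split.
- by rewrite /D; lra.
- exact: xi01.
- exact: cifs_compact hS.
- by exists x0.
- exact: cifs_index_nonempty hS.
- by move=> w x /(word_map_extension w)[].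
- by move=> x y Xx Xy; rewrite (le_trans (hB _ _ Xx Xy))// /D; lra.
- rewrite lamE; exact: (dnorm_nil hS (XV _ Xx0)).
- exact: lam0.
- move=> u v; apply: (DL K) => //; first by rewrite /D; lra.
  by rewrite lam_cat mulrA ler_wpM2r ?(ltW (lam0 v))// lamU.
- move=> u v; apply: (DL K); [by rewrite /D; lra|exact: ltW|].
  rewrite lam_cat mulrA ler_wpM2r ?(ltW (lam0 v))//.
  by rewrite mulrC -ler_pdivrMr// lamL.
- move=> w; rewrite lamE; exact: (decay w _ (XV _ Xx0)).
- move=> w x y Xx Xy; apply: (DL L); [by rewrite /D; lra| |].
    by rewrite mulr_ge0// ltW.
  by rewrite -!Tx//; exact: lip.
- move=> w x y Xx Xy; rewrite -!Tx//.
  (* Within lifting range the lifted segment ends at [y] by injectivity; beyond it, the bound [B] on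
     distances in [X] suffices. *)
  have [le|lt] := lerP (a * `|T w y - T w x|) (lam w * delta).
    have [z [Vz Tz zx]] := lift w x (T w y - T w x) Xx le.
    apply: (DL a) => //; first by rewrite /D; lra.
    rewrite distrC [in X in _ <= X]distrC (le_trans _ zx)//.
    suff -> : z = y by [].
    by apply: (word_map_inj hS (w := w)) => //; [exact: XV|rewrite Tz addrC subrK].
  apply: (DL (a / delta * B)) => //; first by rewrite /D; lra.
  apply: (@le_trans _ _ (lam w * B)); first by rewrite ler_wpM2l ?(ltW (lam0 w))// hB.
  by rewrite mulrAC ler_wpM2r ?(ltW B0)// mulrAC ler_pdivlMr// ltW// distrC.
- move=> u v x y uv neq Xx Xy; rewrite -!Tx//.
  apply: (DL (a / delta)) => //; first by rewrite /D; lra.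
  (* Were the points closer, [T v y] would also have a preimage in [V] under [T u], and words of
     equal length with meeting images coincide. *)
  rewrite mulrAC ler_pdivlMr// leNgt; apply/negP => lt.
  have [|z [Vz Tz _]] := lift u x (T v y - T u x) Xx; first by rewrite distrC ltW.
  apply: neq; apply: (word_map_disjoint hS hV uv Vz (XV _ Xy)).
  by rewrite Tz addrC subrK.
Qed.
End MetricBounds.

(** * Packings *)

Section Packing.
Context {R : realType} {d : nat}.
Local Notation E := 'rV[R]_d.
Implicit Types (A : set E) (s : seq E).

Definition separated (r : R) s :=
  uniq s /\ forall x y, x \in s -> y \in s -> x != y -> r <= `|x - y|.

(** Counts of separated points in sup-norm balls transport directly along bi-Lipschitz maps. For the
    same exponent this is equivalent to [covering_bound], the condition under the infimum in
    [assouad_dim], when [d] is positive. *)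
Definition packing_bound (alpha : R) A :=
  exists2 C : R, 0 < C & forall (x : E) (r rho : R) s,
    A x -> 0 < r -> r <= rho -> separated r s ->
    (forall y, y \in s -> A y /\ `|y - x| < rho) ->
    (size s)%:R <= C * (rho / r) `^ alpha.

Definition covering_bound (alpha : R) A :=
  exists2 C : R, 0 < C & forall (x : E) (r rho : R),
    A x -> 0 < r -> r < rho ->
    (covering_number r (eball x rho `&` A) <= (C * (rho / r) `^ alpha)%:E)%E.

Lemma separated_map (r : R) s (f : E -> E) : 0 < r -> uniq s ->
  (forall x y, x \in s -> y \in s -> x != y -> r <= `|f x - f y|) ->
  separated r [seq f x | x <- s].
Proof.
move=> r0 us sf; split.
  rewrite map_inj_in_uniq// => x y xs ys fxy; apply/eqP; apply/negPn/negP => xy.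
  by have := sf _ _ xs ys xy; rewrite fxy subrr normr0 leNgt r0.
move=> _ _ /mapP[x xs ->] /mapP[y ys ->] fxy; apply: sf => //.
by apply: contraNneq fxy => ->.
Qed.

(** A ball of radius [r / 2] holds at most one point of an [r]-separated set, so choosing a ball for
    each point is injective. *)
Lemma packing_le_covering (r : R) A s : separated r s ->
  (forall y, y \in s -> A y) ->
  ((size s)%:R%:E <= covering_number (r / 2) A)%E.
Proof.
move=> [us ss] sA; apply: le_ereal_inf_tmp => _ [n [c Ac] <-].
rewrite lee_fin ler_nat.
have /choice [g hg] y : exists k : nat, y \in s ->
    exists i : 'I_n, k = i /\ eball (c i) (r / 2) y.
  have [/sA/Ac [i _ yi]|ns] := boolP (y \in s); last by exists 0%N.
  by exists i => _; exists i.
suff ug : uniq [seq g y | y <- s].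
  rewrite -(size_map g) -[n](size_iota 0); apply: uniq_leq_size => //.
  by move=> _ /mapP[y /hg [i [-> _]] ->]; rewrite mem_iota /=.
rewrite map_inj_in_uniq// => x y xs ys gxy.
have [i [gi xi]] := hg _ xs; have [j [gj yj]] := hg _ ys.
have ij : i = j by apply: val_inj; rewrite /= -gi -gj.
apply/eqP; apply/negPn/negP => /(ss _ _ xs ys); rewrite leNgt => /negP; apply.
have b z k : eball (c k) (r / 2) z -> `|z - c k| < r / 2.
  by apply: le_lt_trans; exact: le_norm_enorm.
rewrite (le_lt_trans (ler_distD (c i) _ _))// [r]splitr ltrD ?b//.
by rewrite distrC b// ij.
Qed.

Lemma packing_of_covering (alpha : R) A : (0 < d)%N ->
  covering_bound alpha A -> packing_bound alpha A.
Proof.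
move=> d0 [C C0 hC]; have dd : 1 <= d%:R :> R by rewrite ler1n.
have d20 : 0 < 2 * d%:R :> R by rewrite mulr_gt0// (lt_le_trans ltr01).
exists (C * (2 * d%:R) `^ alpha) => [|x r rho s Ax r0 rrho ss sA].
  by rewrite mulr_gt0// powR_gt0.
have rho0 : 0 < rho by exact: lt_le_trans rrho.
have r2 : r / 2 < d%:R * rho.
  rewrite (@lt_le_trans _ _ rho) ?ler_peMl ?(ltW rho0)//.
  by rewrite (lt_le_trans _ rrho)// ltr_pdivrMr// ltr_pMr// ltr1n.
have := hC x (r / 2) (d%:R * rho) Ax (divr_gt0 r0 (ltr0Sn _ 1)) r2.
have /(packing_le_covering ss) h : forall y, y \in s -> (eball x (d%:R * rho) `&` A) y.
  move=> y /sA [Ay yx]; split=> //; rewrite /eball /= (le_lt_trans (le_enorm_norm _))//.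
  by rewrite ltr_pM2l// (lt_le_trans ltr01).
move=> /(le_trans h); rewrite lee_fin => /le_trans; apply.
have <- : 2 * d%:R * (rho / r) = d%:R * rho / (r / 2) by field; rewrite gt_eqF.
by rewrite powRM ?mulrA// ?divr_ge0 ?ltW.
Qed.

(** A separated set of maximal cardinality is a net, since a point far from all its members could be
    added; the packing bound makes a maximum exist. *)
Lemma covering_of_packing (alpha : R) A : (0 < d)%N ->
  packing_bound alpha A -> covering_bound alpha A.
Proof.
move=> d0 [C C0 hC]; have dd : 1 <= d%:R :> R by rewrite ler1n.
have dd0 : 0 < d%:R :> R by rewrite ltr0n.
exists (C * d%:R `^ alpha) => [|x r rho Ax r0 rrho].
  by rewrite mulr_gt0// powR_gt0.
have rho0 : 0 < rho by exact: lt_trans rrho.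
(* Sup-norm distance below [r / d] forces Euclidean distance below [r]. *)
pose r' := r / d%:R.
have r'0 : 0 < r' by rewrite divr_gt0.
have r'rho : r' <= rho.
  by rewrite (le_trans _ (ltW rrho))// ler_pdivrMr// ler_peMr// ltW.
pose good s := separated r' s /\ forall y, y \in s -> A y /\ eball x rho y.
have gsize s : good s -> (size s)%:R <= C * (rho / r') `^ alpha.
  move=> [ss sA]; apply: (hC x r' rho s Ax r'0 r'rho ss) => y /sA [Ay yx].
  by split=> //; rewrite (le_lt_trans (le_norm_enorm _)).
pose P n := `[< exists2 s, good s & size s = n >].
have P0 : exists n, P n by exists 0%N; apply/asboolP; exists [::].
have Pmax n : P n -> (n <= Num.trunc (C * (rho / r') `^ alpha))%N.
  move=> /asboolP [s gs <-].
  by rewrite -ltnS -(ltr_nat R) (le_lt_trans (gsize _ gs))// truncnS_gt.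
case: (ex_maxnP P0 Pmax) => n /asboolP [s gs sn] nmax.
apply: (@le_trans _ _ n%:R%:E); last first.
  rewrite lee_fin -sn (le_trans (gsize _ gs))//.
  have -> : rho / r' = d%:R * (rho / r) by rewrite /r'; field; rewrite !gt_eqF.
  by rewrite powRM ?mulrA ?lexx// divr_ge0 ?ltW.
apply: ereal_inf_lbound; exists n => //; exists (fun i : 'I_n => nth x s i).
move=> y [yx Ay].
have [z zs zy] : exists2 z, z \in s & enorm (y - z) < r.
  have [ys|ys] := boolP (y \in s).
    exists y => //; rewrite subrr (le_lt_trans (le_enorm_norm _))//.
    by rewrite normr0 mulr0.
  apply: contrapT => /forall2NP far.
  suff : P n.+1 by move/nmax; rewrite ltnn.
  apply/asboolP; exists (y :: s); last by rewrite /= sn.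
  have far' z : z \in s -> r' <= `|y - z|.
    move=> zs; rewrite leNgt; apply/negP => lt; case: (far z) => //; apply.
    rewrite (le_lt_trans (le_enorm_norm _))//.
    by rewrite mulrC -ltr_pdivlMr.
  case: gs => -[us ss] sA; split; last first.
    by move=> z; rewrite inE => /orP[/eqP ->|/sA].
  split; first by rewrite /= ys us.
  move=> a b; rewrite !inE => /orP[/eqP ->|sa] /orP[/eqP ->|sb].
  - by rewrite eqxx.
  - by move=> _; exact: far'.
  - by move=> _; rewrite distrC; exact: far'.
  - exact: ss.
have zn : (index z s < n)%N by rewrite -sn index_mem.
by exists (Ordinal zn) => //=; rewrite nth_index.
Qed.

End Packing.

(** * Coding of the limit set *)

Lemma mkseqD (I : Type) (f : nat -> I) m n :
  mkseq f (m + n) = mkseq f m ++ mkseq (fun k => f (m + k)%N) n.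
Proof. by rewrite /mkseq iotaD map_cat add0n -{2}[m]addn0 iotaDl -map_comp. Qed.

Section Coding.
Context {R : realType} {d : nat} {I : choiceType}.
Local Notation E := 'rV[R]_d.
Context {X : set E} {S : I -> E -> E} {lam : seq I -> R} {D xi : R}.
Hypothesis H : conformal_bounds X S lam D xi.
Local Notation T := (word_map S).
Local Notation F := (limit_set X S).
Implicit Types (om : nat -> I) (u v w : seq I) (x y z : E).

Lemma cb_D_gt0 : 0 < D.
Proof. by rewrite (lt_le_trans ltr01)// (cb_D_ge1 H). Qed.

Lemma cb_lam_ge0 w : 0 <= lam w.
Proof. exact/ltW/(cb_lam_gt0 H). Qed.

Lemma cb_xi_gt0 : 0 < xi.
Proof. by have /andP[] := cb_xi H. Qed.

Lemma cb_xi_lt1 : xi < 1.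
Proof. by have /andP[] := cb_xi H. Qed.

Lemma cb_inj w x y : X x -> X y -> T w x = T w y -> x = y.
Proof.
move=> Xx Xy e; have := cb_colip H w Xx Xy.
rewrite e subrr normr0 mulr0 pmulr_rle0 ?(cb_lam_gt0 H)// normr_le0 subr_eq0.
by move/eqP.
Qed.

(** Level 0 is included, so a coded point lies in [X] at once; the limit set asks only for positive
    levels, which [limit_setP] reconciles. *)
Definition coded om y := forall n, (T (mkseq om n) @` X) y.

Lemma coded_in om y n : coded om y -> exists2 x, X x & y = T (mkseq om n) x.
Proof. by move=> /(_ n) [x Xx <-]; exists x. Qed.

Lemma codedX om y : coded om y -> X y.
Proof. by move=> /(_ 0%N) [x Xx <-]. Qed.

Lemma limit_setP y : F y <-> exists om, coded om y.
Proof.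
split=> [[om _ omy]|[om omy]]; last by exists om.
exists om => -[|n]; last exact: omy.
have [//|x Xx xy] := omy 1%N; exists y => //.
by rewrite -xy; exact: (cb_maps H).
Qed.

Lemma limit_setX y : F y -> X y.
Proof. by move=> /limit_setP[om /codedX]. Qed.

Lemma coded_shift om y n : coded om y ->
  exists2 z, coded (fun k => om (n + k)%N) z & y = T (mkseq om n) z.
Proof.
move=> omy; have [z Xz yz] := coded_in n omy; exists z => // m.
have [x Xx] := coded_in (n + m) omy; rewrite mkseqD word_map_cat yz => e.
by exists x => //; apply/esym/(cb_inj Xz _ e)/(cb_maps H).
Qed.

Lemma coded_cons om z i : coded om z ->
  coded (fun k => if k is k'.+1 then om k' else i) (T [:: i] z).
Proof.
move=> omz [|n].
  by exists (T [:: i] z) => //; apply: (cb_maps H); exact: codedX omz.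
have [x Xx ->] := coded_in n omz; exists x => //.
have -> // : mkseq (fun k => if k is k'.+1 then om k' else i) n.+1 = i :: mkseq om n.
by rewrite -add1n mkseqD.
Qed.

Lemma coded_separation om om' y y' n : coded om y -> coded om' y' ->
  mkseq om n <> mkseq om' n -> lam (mkseq om n) <= D * `|y - y'|.
Proof.
move=> /(coded_in n)[x Xx ->] /(coded_in n)[x' Xx' ->] neq.
by apply: (cb_sep H) => //; rewrite !size_mkseq.
Qed.

(** A cluster point of the images of [x0] under the prefixes works: the cylinder of level [n] is
    compact, hence closed, and contains all images from index [n] on. *)
Lemma coded_exists om : exists y, coded om y.
Proof.
have [x0 Xx0] := cb_nonempty H.
pose a n := T (mkseq om n) x0.
have [|y [Xy cy]] := cb_compact H (F := a @ \oo).
  by exists 0%N => // n _; exact: (cb_maps H).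
exists y => n.
have cT : {within X, continuous (T (mkseq om n))}.
  apply/subspace_continuousP => x Xx; apply/cvgrPdist_lt => e e0.
  have c0 : 0 < D * lam (mkseq om n) by rewrite mulr_gt0 ?cb_D_gt0 ?(cb_lam_gt0 H).
  have : \forall z \near x, `|x - z| < e / (D * lam (mkseq om n)).
    by apply/nbhs_normP; exists (e / (D * lam (mkseq om n))) => //=; rewrite divr_gt0.
  apply: filterS => z xz Xz; rewrite (le_lt_trans (cb_lip H _ Xx Xz))//.
  by rewrite mulrA mulrC -ltr_pdivlMr.
have : closed (T (mkseq om n) @` X).
  apply: compact_closed; first exact: norm_hausdorff.
  by apply: continuous_compact => //; exact: (cb_compact H).
apply => B By; apply: cy => //.
exists n => // m /= nm; exists (T (mkseq (fun k => om (n + k)%N) (m - n)) x0).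
  exact: (cb_maps H).
by rewrite -word_map_cat -mkseqD subnKC.
Qed.

Lemma limit_set_nonempty : F !=set0.
Proof.
have [i _] := cb_index H; have [y yi] := coded_exists (fun=> i).
by exists y; apply/limit_setP; exists (fun=> i).
Qed.
End Coding.

(** * Level sums and the Hausdorff measure *)

Lemma exists_expr_lt (R : realType) (x e : R) : 0 <= x < 1 -> 0 < e ->
  exists k, x ^+ k < e.
Proof.
move=> /andP[x0 x1] e0; have x1' : `|x| < 1 by rewrite ger0_norm.
have /cvgr0_norm_lt /(_ _ e0) [k _ hk] := cvg_expr x1'.
by exists k; have := hk k (leqnn k); rewrite /= ger0_norm// exprn_ge0.
Qed.

Lemma geometric_sum_le (R : realType) (x : R) n : 0 <= x < 1 ->
  \sum_(i < n) x ^+ i <= (1 - x)^-1.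
Proof.
move=> /andP[x0 x1]; have x10 : 0 < 1 - x by rewrite subr_gt0.
rewrite -[leRHS]mul1r ler_pdivlMr// mulrC -opprB mulNr -subrX1 opprB.
by rewrite gerBl exprn_ge0.
Qed.

(** * Avoiding a light family of words in a weighted tree *)

Section TreeDescent.
Context {R : realType} {I : choiceType}.

(** The mass [f] does not shrink when a word is replaced by its children [u ++ q]. If the words
    [c k] below [u] carry at most the fraction [theta] of [f u], some child inherits this, and
    following such children gives a branch that avoids every [c k]. *)
Lemma tree_descent (f : seq I -> R) (Q : seq (seq I)) (n : nat)
    (c : nat -> seq I) (theta : R) :
  (0 < n)%N -> uniq Q -> (forall q, q \in Q -> size q = n) ->
  (forall u, 0 < f u) -> (forall u, f u <= \sum_(q <- Q) f (u ++ q)) ->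
  0 < theta < 1 -> (forall N, \sum_(k < N) f (c k) <= theta * f [::]) ->
  exists om : nat -> I,
    (forall m, mkseq (fun j => om (m * n + j)%N) n \in Q) /\
    forall k m, mkseq om (m * n) <> c k.
Proof.
move=> n0 uQ sQ f0 fQ /andP[t0 t1] fc.
pose load u N := \sum_(k < N | prefix u (c k)) f (c k).
pose good u := forall N, load u N <= theta * f u.
have load_le u N N' : (N <= N')%N -> load u N <= load u N'.
  move=> NN'; rewrite /load.
  rewrite (big_ord_widen_cond _ (fun k => prefix u (c k)) (fun k => f (c k)) NN').
  rewrite [leRHS](bigID (fun k : 'I_N' => (k < N)%N)) /=.
  by rewrite lerDl sumr_ge0// => k _; exact: ltW.
(* If all children were overloaded, their loads would add up to more than [theta * f u]; but each
   [c k] lies below at most one child, as the blocks of [Q] have equal length. *)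
have step u : good u -> exists2 q, q \in Q & good (u ++ q).
  move=> gu; apply: contrapT => /forall2NP bad.
  have /choice [N hN] q : exists N, q \in Q -> theta * f (u ++ q) < load (u ++ q) N.
    have [/negP nq|/existsNP[N hN]] := bad q; first by exists 0%N; rewrite (negbTE nq).
    by exists N => _; rewrite ltNge; exact/negP.
  pose N0 := \max_(q <- Q) N q.
  have hN0 q : q \in Q -> theta * f (u ++ q) < load (u ++ q) N0.
    move=> qQ; rewrite (lt_le_trans (hN _ qQ))// load_le//.
    exact: leq_bigmax_seq.
  have le1 : \sum_(q <- Q) load (u ++ q) N0 <= load u N0.
    rewrite /load (exchange_big_dep (fun k : 'I_N0 => prefix u (c k))) /=; last first.
      by move=> q k _; exact: catl_prefix.
    apply: ler_sum => k uk; rewrite big_const_seq.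
    have : (count (fun q => prefix (u ++ q) (c k)) Q <= 1)%N.
      have [u' cu] := prefixP uk.
      rewrite (eq_in_count (a2 := pred1 (take n u'))) ?count_uniq_mem ?leq_b1//.
      move=> q qQ /=; rewrite cu prefix_catr// eqxx /= prefixE sQ//.
    case: (count _ _) => [|[|//]] _ /=; first exact: ltW.
    by rewrite addr0.
  have lt2 : theta * \sum_(q <- Q) f (u ++ q) < \sum_(q <- Q) load (u ++ q) N0.
    have [q qQ] : exists q, q \in Q.
      have [e|] := eqVneq Q [::].
        by have := fQ [::]; rewrite e big_nil leNgt f0.
      by case: (Q) => // q s _; exists q; rewrite mem_head.
    rewrite mulr_sumr !(bigD1_seq q qQ uQ) /=.
    rewrite ltr_leD ?hN0// big_seq_cond [leRHS]big_seq_cond.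
    by apply: ler_sum => q' /andP[q'Q _]; exact/ltW/hN0.
  have := lt_le_trans lt2 (le_trans le1 (gu N0)).
  by rewrite ltr_pM2l// ltNge fQ.
have /choice [g hg] u : exists q, good u -> q \in Q /\ good (u ++ q).
  by have [/step [q]|] := pselect (good u); [exists q|exists [::]].
pose P m := iter m (fun u => u ++ g u) [::].
have gP m : good (P m).
  elim: m => [N|m IH]; last by have [_] := hg _ IH.
  rewrite /load (eq_bigl xpredT); first exact: fc.
  by move=> k; rewrite prefixE take0.
have gQ m : g (P m) \in Q by have [] := hg _ (gP m).
have sP m : size (P m) = (m * n)%N.
  by elim: m => //= m IH; rewrite size_cat IH sQ// mulSn addnC.
have [i0 _] : exists i0 : I, true.
  have := sQ _ (gQ 0%N); case: (g (P 0%N)) => [/= e|i]; last by exists i.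
  by move: n0; rewrite -e.
(* [P j.+1] has [j.+1 * n] letters, more than [j], so the default [i0] is never read. *)
pose om j := nth i0 (P j.+1) j.
have Pnth m k j : (j < m * n)%N -> nth i0 (P (m + k)%N) j = nth i0 (P m) j.
  move=> jm; elim: k => [|k <-]; first by rewrite addn0.
  rewrite addnS /= nth_cat sP (leq_trans jm)//.
  by rewrite leq_mul2r leq_addr orbT.
have omP m : mkseq om (m * n) = P m.
  apply: (@eq_from_nth _ i0); rewrite size_mkseq ?sP// => j jm.
  rewrite nth_mkseq// /om.
  have jj : (j < j.+1 * n)%N by rewrite -[j.+1 in X in (X <= _)%N]muln1 leq_mul2l n0 orbT.
  have [le|lt] := leqP j.+1 m.
    by rewrite -(subnKC le) Pnth.
  by rewrite -(subnKC (ltnW lt)) Pnth.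
exists om; split=> [m|k m].
  have := omP m.+1; rewrite mulSn addnC mkseqD omP /= => /eqP.
  by rewrite eqseq_cat// => /andP[_ /eqP ->].
(* A prefix equal to [c k] would bear its whole mass as load, more than the fraction [theta < 1]. *)
rewrite omP => e; have := gP m k.+1.
rewrite /load big_mkcond big_ord_recr /= -big_mkcond /= -e prefix_refl.
apply/negP; rewrite -ltNge (@lt_le_trans _ _ (f (P m)))//.
  by rewrite gtr_pMl.
by rewrite lerDr sumr_ge0// => j _; exact: ltW.
Qed.
End TreeDescent.

Lemma powR_mono (R : realType) (s x y : R) : 0 <= s -> 0 <= x -> x <= y ->
  x `^ s <= y `^ s.
Proof.
by move=> s0 x0 xy; apply: ge0_ler_powR; rewrite ?nnegrE// (le_trans x0).
Qed.

Section LevelSums.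
Context {R : realType} {d : nat} {I : choiceType}.
Local Notation E := 'rV[R]_d.
Context {X : set E} {S : I -> E -> E} {lam : seq I -> R} {D xi : R}.
Hypothesis H : conformal_bounds X S lam D xi.
Local Notation T := (word_map S).
Local Notation F := (limit_set X S).
Implicit Types (om : nat -> I) (u v w : seq I) (x y z : E).

Local Notation coded := (@coded R d I X S).

Let D0 := cb_D_gt0 H.
Let lam0 := cb_lam_gt0 H.
Let lamge0 := cb_lam_ge0 H.

Lemma lam_powR_small (s e : R) : 0 < s -> 0 < e ->
  exists k, forall w, (k <= size w)%N -> lam w `^ s <= e.
Proof.
move=> s0 e0; have [k hk] := exists_expr_lt (x := xi) (e := e `^ s^-1)
  (introT andP (conj (ltW (cb_xi_gt0 H)) (cb_xi_lt1 H))) (powR_gt0 _ e0).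
exists k => w kw; have sn0 : s != 0 by rewrite gt_eqF.
have -> : e = (e `^ s^-1) `^ s by rewrite -powRrM mulVf// powRr1// ltW.
apply: powR_mono; rewrite ?ltW//.
rewrite (le_lt_trans (cb_lam_decay H w))// (le_lt_trans _ hk)//.
by rewrite ler_wiXn2l ?ltW ?(cb_xi_gt0 H) ?(cb_xi_lt1 H).
Qed.

Section Branches.
Context (Q : seq (seq I)) (n : nat) (c s : R).
Hypotheses (n0 : (0 < n)%N) (c0 : 0 < c)
  (lamQ : forall q, q \in Q -> c <= lam q) (s0 : 0 < s).

Definition branch om := forall m, mkseq (fun j => om (m * n + j)%N) n \in Q.

(* Two coded points of U whose words first differ after u are at distance
   comparable to at least lam u, so a small set lies in a small cylinder. *)
Lemma cylinder_cover (U : set E) (delta eps : R) : 0 <= delta -> 0 < eps ->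
  (forall y y', U y -> U y' -> `|y - y'| <= delta) ->
  exists u m, [/\ size u = (m * n)%N,
    lam u `^ s <= (D ^+ 2 / c) `^ s * delta `^ s + eps &
    forall om y, branch om -> coded om y -> U y -> mkseq om (m * n) = u].
Proof.
move=> de0 eps0 Ud; have K0 : 0 <= D ^+ 2 / c.
  by rewrite divr_ge0 ?exprn_ge0 ?ltW.
have [k hk] := lam_powR_small s0 eps0.
have kn : (k <= k * n)%N by rewrite leq_pmulr.
have tail0 : 0 <= (D ^+ 2 / c) `^ s * delta `^ s by rewrite mulr_ge0 ?powR_ge0.
(* With no branch point in [U] the last clause is vacuous and any deep cylinder will do, its size
   being paid by [eps]; the case [delta = 0] is paid the same way. *)
have [[om0 [y0 [br0 [cod0 Uy0]]]]|none] := pselect (exists om y,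
    branch om /\ coded om y /\ U y); last first.
  have [i _] := cb_index H; exists (mkseq (fun=> i) (k * n)), k.
  split; first by rewrite size_mkseq.
    by rewrite (le_trans (hk _ _)) ?size_mkseq// lerDr.
  by move=> om y b co Uy; exfalso; apply: none; exists om, y.
have agree m : (m = 0%N \/ D * delta < lam (mkseq om0 (m * n))) ->
    forall om y, branch om -> coded om y -> U y ->
      mkseq om (m * n) = mkseq om0 (m * n).
  case=> [-> //|lt] om y _ co Uy; apply: contrapT => neq.
  have := coded_separation H cod0 co (nesym neq).
  rewrite leNgt => /negP; apply; rewrite (le_lt_trans _ lt)// ler_wpM2l ?(ltW D0)//.
  exact: Ud.
have [dz|dn0] := eqVneq delta 0.
  exists (mkseq om0 (k * n)), k; split; first by rewrite size_mkseq.
    by rewrite (le_trans (hk _ _)) ?size_mkseq// lerDr.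
  by apply: agree; right; rewrite dz mulr0.
have dgt0 : 0 < delta by rewrite lt_neqAle eq_sym dn0.
(* Stop one block before [lam] first drops to [D * delta]. Separation makes all branches in [U]
   share this prefix, and one block shrinks [lam] at most by the factor [c / D], whence
   [D ^+ 2 / c]. *)
have ex : exists m, lam (mkseq om0 (m.+1 * n)) <= D * delta.
  have [k' hk'] := exists_expr_lt (x := xi)
    (introT andP (conj (ltW (cb_xi_gt0 H)) (cb_xi_lt1 H))) (mulr_gt0 D0 dgt0).
  exists k'; rewrite (le_trans (cb_lam_decay H _))// (le_trans _ (ltW hk'))//.
  rewrite size_mkseq ler_wiXn2l ?ltW ?(cb_xi_gt0 H) ?(cb_xi_lt1 H)//.
  by rewrite (leq_trans (leqnSn _))// leq_pmulr.
case: (ex_minnP ex) => m hm mmin.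
exists (mkseq om0 (m * n)), m; split; first by rewrite size_mkseq.
  rewrite -powRM// (@le_trans _ _ ((D ^+ 2 / c * delta) `^ s)) ?lerDl ?(ltW eps0)//.
  rewrite powR_mono ?(ltW s0)// mulrAC ler_pdivlMr//.
  have := cb_lam_cat_ge H (mkseq om0 (m * n)) (mkseq (fun j => om0 (m * n + j)%N) n).
  rewrite -mkseqD addnC -mulSn => le.
  rewrite (@le_trans _ _ (D * (D * delta)))//; last by rewrite expr2 -mulrA.
  rewrite (@le_trans _ _ (D * lam (mkseq om0 (m.+1 * n))))//; last first.
    by rewrite ler_wpM2l// ltW.
  by rewrite (le_trans _ le)// ler_wpM2l// lamQ.
apply: agree; case: m hm mmin => [|m] hm mmin; [by left|right].
rewrite ltNge; apply/negP => /mmin; by rewrite ltnn.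
Qed.
End Branches.

Lemma ediamP (U : set E) (delta : R) : U !=set0 -> (ediam U <= delta%:E)%E ->
  exists2 r : R, 0 <= r & ediam U = r%:E /\ forall y y', U y -> U y' -> `|y - y'| <= r.
Proof.
move=> [x Ux] Ud.
have le y y' : U y -> U y' -> ((enorm (y - y'))%:E <= ediam U)%E.
  by move=> Uy Uy'; apply: ereal_sup_ubound; exists y, y'.
have : ((enorm (x - x))%:E <= ediam U)%E by exact: le.
move: Ud le; case: (ediam U) => [r||] // Ud le xr.
exists r; first by rewrite -lee_fin (le_trans _ xr)// lee_fin enorm_ge0.
split=> // y y' Uy Uy'; rewrite (le_trans (le_norm_enorm _))// -lee_fin.
exact: le.
Qed.

(** A sum above [D ^ s] would, by quasi-multiplicativity, let [lam ^ s] grow from each word to its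
    children in [Q]. A cover of [F] with tiny content, traded for cylinders, would then be light
    enough for [tree_descent] to yield a branch coding an uncovered point of [F]. *)
Lemma level_sum_le (Q : seq (seq I)) (n : nat) (s : R) :
  0 < s -> hausdorff_measure s F = 0%E -> uniq Q ->
  (forall q, q \in Q -> size q = n) ->
  \sum_(q <- Q) lam q `^ s <= D `^ s.
Proof.
move=> s0 HF uQ sQ; have D1 : 1 <= D `^ s.
  have <- : 1 `^ s = 1 :> R by rewrite powR1.
  by rewrite powR_mono ?(ltW s0)// (cb_D_ge1 H).
have [n0|n0] := posnP n.
  have Qsub : {subset Q <= [:: [::]]}.
    by move=> q /sQ; rewrite n0 inE => /size0nil ->.
  have := uniq_leq_size uQ Qsub; case: Q uQ sQ Qsub => [|q [|//]] uQ sQ Qsub _.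
    by rewrite big_nil (le_trans ler01).
  have /Qsub : q \in [:: q] by rewrite mem_head.
  by rewrite inE => /eqP ->; rewrite big_seq1 (cb_lam_nil H) powR1.
rewrite leNgt; apply/negP => Zgt.
have Ds0 : 0 < D `^ s by exact: powR_gt0.
have grow u : lam u `^ s <= \sum_(q <- Q) lam (u ++ q) `^ s.
  have us0 : 0 < lam u `^ s by exact: powR_gt0.
  rewrite -(ler_pM2l Ds0) mulr_sumr.
  rewrite (@le_trans _ _ (\sum_(q <- Q) lam u `^ s * lam q `^ s))//.
    by rewrite -mulr_sumr mulrC ler_pM2l// ltW.
  apply: ler_sum => q _; rewrite -!powRM// ?(ltW D0)//.
  by rewrite powR_mono ?(ltW s0) ?mulr_ge0 ?lamge0// (cb_lam_cat_ge H).
have [c c0 lamQ] : exists2 c : R, 0 < c & forall q, q \in Q -> c <= lam q.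
  clear -H; elim: Q => [|q Q [c c0 IH]]; first by exists 1.
  exists (Num.min (lam q) c); first by rewrite lt_min c0 (cb_lam_gt0 H).
  by move=> q'; rewrite inE ge_min => /orP[/eqP ->|/IH ->]; rewrite ?lexx// orbT.
pose K := (D ^+ 2 / c) `^ s.
have K0 : 0 < K by rewrite powR_gt0// divr_gt0// exprn_gt0.
(* With [(4 * K)^-1] the diameters contribute at most 1/4 to the cylinder masses; the errors
   [8^-1 * 2^-1 ^+ k] add at most another 1/4, which gives [theta] equal to 1/2. *)
have [U [FU Ud Usum]] : exists U : nat -> set E, [/\ F `<=` \bigcup_k U k,
    forall k, (ediam (U k) <= 1%:E)%E &
    (\sum_(0 <= k <oo) diam_pow s (U k) < (4 * K)^-1%:E)%E].
  have : (hausdorff_content s 1 F < (4 * K)^-1%:E)%E.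
    apply: (@le_lt_trans _ _ 0%E); last by rewrite lte_fin invr_gt0 mulr_gt0.
    by rewrite -HF; apply: ereal_sup_ubound; exists 1 => //=.
  by move=> /ereal_inf_lt[z [U [FU Ud ->]] lt]; exists U.
have cyl k : exists u, exists b : R, [/\ (exists m, size u = (m * n)%N), 0 <= b,
    diam_pow s (U k) = b%:E, lam u `^ s <= K * b + 8^-1 * 2^-1 ^+ k &
    forall om y, branch Q n om -> coded om y -> U k y -> mkseq om (size u) = u].
  have e0 : 0 < 8^-1 * 2^-1 ^+ k :> R by rewrite mulr_gt0 ?exprn_gt0 ?invr_gt0.
  have [U0|/set0P Un] := eqVneq (U k) set0.
    have [|u [m [su lu hu]]] :=
        @cylinder_cover Q n c s n0 c0 lamQ s0 (U k) 0 _ (lexx _) e0.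
      by move=> y y'; rewrite U0.
    exists u, 0; split => //; first by exists m.
    - by rewrite /diam_pow U0 eqxx.
    - by rewrite (le_trans lu)// powR0 ?gt_eqF// !mulr0.
    - by rewrite su.
  have [r r0 [dU hr]] := ediamP Un (Ud k).
  have [u [m [su lu hu]]] := @cylinder_cover Q n c s n0 c0 lamQ s0 (U k) r _ r0 e0 hr.
  exists u, (r `^ s); split => //; [by exists m|exact: powR_ge0| |by rewrite su].
  rewrite /diam_pow ifF ?dU ?poweR_EFin//.
  by apply/negbTE/set0P.
have /choice [u] := cyl; move=> /choice [b hub].
have b0 k : 0 <= b k by have [] := hub k.
have bsum N : \sum_(k < N) b k <= (4 * K)^-1.
  rewrite -lee_fin (le_trans _ (ltW Usum))// -sumEFin.
  rewrite (eq_bigr (fun k : 'I_N => diam_pow s (U k))); last first.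
    by move=> k _; have [_ _ ->] := hub k.
  rewrite -(big_mkord xpredT (fun k => diam_pow s (U k))).
  apply: nneseries_lim_ge => k _ _; have [_ _ -> _ _] := hub k.
  by rewrite lee_fin.
have [om [br nc]] : exists om : nat -> I, branch Q n om /\
    forall k m, mkseq om (m * n) <> u k.
  apply: (@tree_descent R I (fun w => lam w `^ s) Q n u 2^-1) => //.
  - by move=> w; exact: powR_gt0.
  - by rewrite invr_gt0 ltr0n invf_lt1// ltr1n.
  - move=> N; rewrite (cb_lam_nil H) powR1 mulr1.
    apply: (@le_trans _ _ (\sum_(k < N) (K * b k + 8^-1 * 2^-1 ^+ k))).
      by apply: ler_sum => k _; have [] := hub k.
    rewrite big_split /= -!mulr_sumr.
    have g := @geometric_sum_le R 2^-1 N.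
    have h01 : 0 <= (2^-1 : R) < 1 by rewrite invr_ge0 ler0n invf_lt1// ltr1n.
    have h1 : K * \sum_(k < N) b k <= 4^-1.
      rewrite (le_trans (ler_wpM2l (ltW K0) (bsum N)))// invfM mulrCA divff ?mulr1//.
      by rewrite gt_eqF.
    have e2 : (1 - 2^-1)^-1 = 2 :> R by rewrite (_ : 1 - 2^-1 = 2^-1) ?invrK//; lra.
    have := g h01; rewrite e2 => g2; move: g2 h1; lra.
have [y cy] := coded_exists H om.
have Fy : F y by apply/(limit_setP H); exists om.
have [k _ Uky] := FU _ Fy.
have [[m sm] _ _ _ hu] := hub k.
by apply: (nc k m); rewrite -sm; exact: hu Uky.
Qed.
End LevelSums.

(** * Upper bound for the Assouad dimension *)

Lemma layered_sum_le (R : realType) (J : eqType) (Q : seq J) (a : J -> R)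
    (k : J -> nat) (M theta : R) :
  0 <= theta < 1 -> 0 <= M ->
  (forall n, \sum_(j <- Q | k j == n) a j <= M * theta ^+ n) ->
  \sum_(j <- Q) a j <= M / (1 - theta).
Proof.
move=> th M0 layer; pose N := (\max_(j <- Q) k j).+1.
have -> : \sum_(j <- Q) a j = \sum_(n < N) \sum_(j <- Q | k j == n) a j.
  rewrite (exchange_big_dep xpredT) //=; apply: eq_big_seq => j jQ.
  have kN : (k j < N)%N by rewrite ltnS; exact: leq_bigmax_seq.
  by rewrite (big_pred1 (Ordinal kN)).
apply: (@le_trans _ _ (\sum_(n < N) M * theta ^+ n)); first by apply: ler_sum.
by rewrite -mulr_sumr ler_wpM2l// geometric_sum_le.
Qed.

Lemma size_fibers (J K : eqType) (f : J -> K) (s : seq J) :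
  size s = (\sum_(v <- undup [seq f y | y <- s]) size [seq y <- s | f y == v])%N.
Proof.
rewrite -[LHS](count_predT) -sum1_count.
have -> : (\sum_(y <- s) 1 =
    \sum_(y <- s) \sum_(v <- undup [seq f y | y <- s] | f y == v) 1)%N.
  apply: eq_big_seq => y ys; rewrite -big_filter.
  rewrite (_ : [seq v <- _ | f y == v] = [:: f y]) ?big_seq1//.
  rewrite -(filter_pred1_uniq (undup_uniq [seq f y | y <- s])) ?mem_undup ?map_f//.
  by apply: eq_filter => v; rewrite /= eq_sym.
rewrite (exchange_big_dep xpredT)//=; apply: eq_bigr => v _.
by rewrite size_filter -sum1_count.
Qed.

Lemma powR_lt1 (R : realType) (x a : R) : 0 <= x < 1 -> 0 < a -> x `^ a < 1.
Proof.
move=> /andP[x0 x1] a0; have <- : 1 `^ a = 1 :> R by rewrite powR1.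
by apply: gt0_ltr_powR; rewrite // nnegrE.
Qed.

Lemma powRXn (R : realType) (x a : R) n : 0 <= x -> (x ^+ n) `^ a = (x `^ a) ^+ n.
Proof. by move=> x0; rewrite -!powR_mulrn ?powR_ge0// -!powRrM mulrC. Qed.

Lemma packing_bound_mono (R : realType) d (A : set 'rV[R]_d) (alpha beta : R) :
  alpha <= beta -> packing_bound alpha A -> packing_bound beta A.
Proof.
move=> ab [C C0 hC]; exists C => // x r rho s Ax r0 rrho ss sA.
rewrite (le_trans (hC x r rho s Ax r0 rrho ss sA))// ler_wpM2l ?(ltW C0)//.
by apply: ler_powR => //; rewrite ler_pdivlMr// mul1r.
Qed.

Lemma perturbed_separation (R : realType) (E : normedModType R) (r : R) (a b a' b' : E) :
  r <= `|a - b| -> `|a - a'| <= r / 4 -> `|b - b'| <= r / 4 -> r / 2 <= `|a' - b'|.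
Proof.
move=> h1 h2 h3; have h4 := ler_distD a' a b; have h5 := ler_distD b' a' b.
rewrite (distrC b b') in h3; lra.
Qed.

(** * Packing estimates for the limit set *)

Section UpperBound.
Context {R : realType} {d : nat} {I : choiceType}.
Local Notation E := 'rV[R]_d.
Context {X : set E} {S : I -> E -> E} {lam : seq I -> R} {D xi : R}.
Hypothesis H : conformal_bounds X S lam D xi.
Local Notation T := (word_map S).
Local Notation F := (limit_set X S).
Local Notation coded := (@coded R d I X S).
Implicit Types (om : nat -> I) (u v w : seq I) (x y z : E).

Let D0 := cb_D_gt0 H.
Let D1 := cb_D_ge1 H.
Let lam0 := cb_lam_gt0 H.
Let lamge0 := cb_lam_ge0 H.

Context (s alpha beta : R) (P : set E) (p : I -> E).
Hypotheses (levels : forall (Q : seq (seq I)) n, uniq Q ->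
    (forall q, q \in Q -> size q = n) -> \sum_(q <- Q) lam q `^ s <= D `^ s)
  (sb : s < beta) (ab : alpha < beta) (packP : packing_bound alpha P)
  (beta0 : 0 < beta)
  (Pp : forall i, P (p i)) (pX : forall i, (T [:: i] @` X) (p i)).

(** At length [n] the excess exponent [beta - s] gains the factor [theta ^+ n] over the bounded
    level sum, leaving a geometric series. *)
Lemma words_sum_le : exists2 C : R, 0 < C &
  forall Q : seq (seq I), uniq Q -> \sum_(q <- Q) lam q `^ beta <= C.
Proof.
pose theta := xi `^ (beta - s).
have th : 0 <= theta < 1.
  rewrite powR_ge0 powR_lt1 ?subr_gt0// (ltW (cb_xi_gt0 H)).
  exact: cb_xi_lt1 H.
have th1 : theta < 1 by case/andP: th.
exists (D `^ s / (1 - theta)); first by rewrite divr_gt0 ?powR_gt0 ?subr_gt0.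
move=> Q uQ; apply: (@layered_sum_le _ _ Q _ size) => // [|n]; first exact: powR_ge0.
apply: (@le_trans _ _ (\sum_(q <- [seq q <- Q | size q == n]) lam q `^ s * theta ^+ n)).
  rewrite -big_filter big_seq [leRHS]big_seq; apply: ler_sum => q.
  rewrite mem_filter => /andP[/eqP sq _].
  have -> : beta = s + (beta - s) by rewrite addrC subrK.
  rewrite powRD; last by rewrite (gt_eqF (lam0 q)) implybT.
  rewrite ler_wpM2l ?powR_ge0// -powRXn ?(ltW (cb_xi_gt0 H))//.
  by rewrite powR_mono ?subr_ge0 ?(ltW sb) ?lamge0// -sq (cb_lam_decay H).
rewrite -mulr_suml ler_wpM2r ?exprn_ge0 ?powR_ge0//.
apply: (@levels _ n); first exact: filter_uniq.
by move=> q; rewrite mem_filter => /andP[/eqP].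
Qed.

Lemma base_point_separation i j : i != j -> lam [:: i] <= D * `|p i - p j|.
Proof.
move=> ij; have [x Xx <-] := pX i; have [y Xy <-] := pX j.
apply: (cb_sep H) => //; case; exact/eqP.
Qed.

(** Sort the letters dyadically by [lam [:: j] / rho]. In layer [n] the points [p j] are separated
    by order [2^-n rho], so there are at most order [2^(n alpha)] of them, each contributing at most
    [(2^-n rho)^beta]; as [alpha < beta], the layers are summable. *)
Lemma letters_sum_le : exists2 C : R, 0 < C &
  forall i0 (rho : R) (J : seq I), 0 < rho -> uniq J ->
    (forall j, j \in J -> lam [:: j] <= rho /\ `|p j - p i0| < rho) ->
    \sum_(j <- J) lam [:: j] `^ beta <= C * rho `^ beta.
Proof.
have [C C0 hC] := packP.
pose theta : R := 2^-1 `^ (beta - alpha).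
have h0 : 0 < 2^-1 :> R by rewrite invr_gt0.
have h1 : 2^-1 < 1 :> R by rewrite invf_lt1// ltr1n.
have th : 0 <= theta < 1 by rewrite powR_ge0 powR_lt1 ?subr_gt0// (ltW h0).
have th1 : theta < 1 by case/andP: th.
pose M := C * (2 * D) `^ alpha.
have M0 : 0 < M by rewrite mulr_gt0// powR_gt0// mulr_gt0.
exists (M / (1 - theta)); first by rewrite divr_gt0 ?subr_gt0.
move=> i0 rho J rho0 uJ hJ.
have /choice [k hk] j : exists k : nat, j \in J ->
    2^-1 ^+ k.+1 * rho < lam [:: j] /\ lam [:: j] <= 2^-1 ^+ k * rho.
  have [/hJ [le _]|nj] := boolP (j \in J); last by exists 0%N.
  have ex : exists k, 2^-1 ^+ k.+1 * rho < lam [:: j].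
    have [k hk] := exists_expr_lt (introT andP (conj (ltW h0) h1))
      (divr_gt0 (lam0 [:: j]) rho0).
    exists k; rewrite -ltr_pdivlMr// (le_lt_trans _ hk)// exprS.
    by rewrite ler_piMl ?(ltW h1) ?exprn_ge0 ?(ltW h0).
  case: (ex_minnP ex) => k hk kmin; exists k => _; split=> //.
  case: k hk kmin => [|k] _ kmin; first by rewrite expr0 mul1r.
  by rewrite leNgt; apply/negP => /kmin; rewrite ltnn.
rewrite mulrAC; apply: (@layered_sum_le _ _ J _ k) => //.
  by rewrite mulr_ge0 ?powR_ge0// ltW.
move=> n; pose Jn := [seq j <- J | k j == n].
have hn : 0 < 2^-1 ^+ n :> R by rewrite exprn_gt0.
pose r : R := 2^-1 ^+ n.+1 * rho / D.
have r0 : 0 < r by rewrite divr_gt0// mulr_gt0// exprn_gt0.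
have size_le : (size Jn)%:R <= C * (rho / r) `^ alpha.
  rewrite -(size_map p); apply: (hC (p i0)) => //.
  - rewrite ler_pdivrMr// mulrC ler_pM2l// (le_trans _ D1)//.
    by rewrite exprn_ile1// ltW.
  - have sep j j' : j \in Jn -> j != j' -> r <= `|p j - p j'|.
      rewrite mem_filter => /andP[/eqP kj jJ] /base_point_separation le.
      rewrite ler_pdivrMr// [leRHS]mulrC (le_trans _ le)// ltW//.
      by have [] := hk _ jJ; rewrite kj.
    have pinj : {in Jn &, injective p}.
      move=> j j' jJ _ pjj; apply/eqP; apply/negPn/negP => /(sep _ _ jJ).
      by rewrite pjj subrr normr0 leNgt r0.
    split; first by rewrite map_inj_in_uniq// filter_uniq.
    move=> _ _ /mapP[j jJ ->] /mapP[j' jJ' ->] pjj; apply: sep => //.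
    by apply: contraNneq pjj => ->.
  - move=> _ /mapP[j + ->]; rewrite mem_filter => /andP[_ /hJ[_ lt]].
    by split.
rewrite -big_filter -/Jn.
apply: (@le_trans _ _ (\sum_(j <- Jn) (2^-1 ^+ n * rho) `^ beta)).
  rewrite big_seq [leRHS]big_seq; apply: ler_sum => j.
  rewrite mem_filter => /andP[/eqP kj jJ].
  by rewrite powR_mono ?(ltW beta0) ?lamge0//; have [_] := hk _ jJ; rewrite kj.
rewrite big_const_seq count_predT iter_addr_0 -[leLHS]mulr_natl.
apply: (le_trans (ler_wpM2r (powR_ge0 _ _) size_le)).
have -> : rho / r = 2 * D / 2^-1 ^+ n.
  by rewrite /r exprS; field; rewrite !gt_eqF.
rewrite [(2^-1 ^+ n * rho) `^ _]powRM ?(ltW hn) ?(ltW rho0)//.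
rewrite [(2 * D / _) `^ _]powRM ?invr_ge0 ?(ltW hn) ?mulr_ge0 ?(ltW D0)//.
have -> : (2^-1 ^+ n)^-1 `^ alpha = (2^-1 ^+ n) `^ (- alpha).
  by rewrite -powR_inv1 ?(ltW hn)// -powRrM mulN1r.
have <- : (2^-1 ^+ n) `^ (- alpha) * (2^-1 ^+ n) `^ beta = theta ^+ n :> R.
  rewrite -powRD; last by rewrite (gt_eqF hn) implybT.
  by rewrite addrC powRXn// ltW.
rewrite le_eqVlt; apply/orP; left; apply/eqP; rewrite /M; ring.
Qed.

Lemma colip_separation v (r : R) y y' z z' : X z -> X z' -> y = T v z -> y' = T v z' ->
  r <= `|y - y'| -> r / (D * lam v) <= `|z - z'|.
Proof.
move=> Xz Xz' -> -> le; rewrite ler_pdivrMr ?mulr_gt0// mulrC -mulrA.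
exact: le_trans le (cb_lip H v Xz Xz').
Qed.

Lemma base_point_near i x : X x -> `|T [:: i] x - p i| <= D ^+ 2 * lam [:: i].
Proof.
move=> Xx; have [x' Xx' <-] := pX i.
rewrite (le_trans (cb_lip H [:: i] Xx Xx'))// expr2 -mulrA ler_wpM2l ?(ltW D0)//.
by rewrite mulrC ler_wpM2r// (cb_diam H).
Qed.

(** Write each point as [T v z], with [v] cut just before [lam] falls below a multiple of [r]. The
    next piece is so small that replacing [z] by a base point at most halves the separation; [packP]
    then allows order [(lam v / r) ^ beta] points per [v], and [words_sum_le] sums over [v]. *)
Lemma global_packing : exists2 C : R, 0 < C & forall (r : R) (t : seq E),
  0 < r -> r <= 4 * D ^+ 4 -> separated r t -> (forall y, y \in t -> F y) ->
  (size t)%:R <= C * r^-1 `^ beta.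
Proof.
have [M M0 hM] := words_sum_le.
have [CP CP0 hCP] := packing_bound_mono (ltW ab) packP.
have Dn n : 0 < D ^+ n by rewrite exprn_gt0.
have Dn1 n : 1 <= D ^+ n by rewrite exprn_ege1.
have D40 : 0 < 4 * D ^+ 4 by rewrite mulr_gt0.
pose C := CP * (8 * D ^+ 5) `^ beta.
have C0 : 0 < C by rewrite mulr_gt0// powR_gt0// mulr_gt0.
exists (C * M); first by rewrite mulr_gt0.
move=> r t r0 rD [ut st] tF.
(* Chosen so that the bound [D ^+ 3 * e / lam v] on the next piece is a quarter of the pulled-back
   separation [r / (D * lam v)]. Since [e <= 1], the empty word starts above the threshold. *)
pose e := r / (4 * D ^+ 4).
have e0 : 0 < e by rewrite divr_gt0.
have e1 : e <= 1 by rewrite ler_pdivrMr// mul1r.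
have stop y : exists vzi : seq I * E * I, y \in t ->
    [/\ X vzi.1.2, y = T vzi.1.1 vzi.1.2, e <= lam vzi.1.1 &
      `|vzi.1.2 - p vzi.2| <= r / (D * lam vzi.1.1) / 4].
  have [i0 _] := cb_index H.
  have [yt|_] := boolP (y \in t); last by exists ([::], 0, i0).
  have /(limit_setP H) [om co] := tF _ yt.
  have ex : exists m, lam (mkseq om m.+1) < e.
    have [k hk] := exists_expr_lt (x := xi)
      (introT andP (conj (ltW (cb_xi_gt0 H)) (cb_xi_lt1 H))) e0.
    exists k; rewrite (le_lt_trans (cb_lam_decay H _))// (le_lt_trans _ hk)//.
    by rewrite size_mkseq ler_wiXn2l ?(ltW (cb_xi_gt0 H)) ?(ltW (cb_xi_lt1 H)).
  case: (ex_minnP ex) => m hm mmin.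
  have [z cz yz] := coded_shift H m co.
  exists (mkseq om m, z, om m) => _ /=; split => //; first exact: codedX cz.
    case: m {hm} mmin {z cz yz} => [|m] mmin; first by rewrite (cb_lam_nil H).
    by rewrite leNgt; apply/negP => /mmin; rewrite ltnn.
  have [z' Xz' zz'] := coded_in 1 cz.
  have -> : z = T [:: om m] z' by rewrite zz' /mkseq /= addn0.
  rewrite (le_trans (base_point_near _ Xz'))//.
  have := cb_lam_cat_ge H (mkseq om m) [:: om m].
  rewrite cats1 -mkseqS => le1.
  have le2 : lam (mkseq om m) * lam [:: om m] <= D * e.
    by rewrite (le_trans le1)// ler_wpM2l ?(ltW D0)// ltW.
  have -> : r / (D * lam (mkseq om m)) / 4 = D ^+ 2 * (D * e / lam (mkseq om m)).
    by rewrite /e; field; rewrite ?mulf_neq0 ?expf_neq0 ?gt_eqF.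
  by rewrite ler_wpM2l ?(ltW (Dn 2%N))// ler_pdivlMr// mulrC.
have /choice [g hg] := stop.
rewrite (size_fibers (fun y => (g y).1.1)) natr_sum.
set W := undup _.
apply: (@le_trans _ _ (\sum_(v <- W) C * r^-1 `^ beta * lam v `^ beta)); last first.
  rewrite -mulr_sumr mulrAC ler_wpM2r ?powR_ge0// ler_wpM2l ?(ltW C0)//.
  by apply: hM; exact: undup_uniq.
rewrite big_seq [leRHS]big_seq; apply: ler_sum => v.
rewrite mem_undup => /mapP[y0 y0t vy0].
have ev : e <= lam v by have [_ _] := hg _ y0t; rewrite -vy0.
have Dv0 : 0 < D * lam v by rewrite mulr_gt0.
pose r' := r / (D * lam v).
have r'0 : 0 < r' by rewrite divr_gt0.
have r'le : r' <= 4 * D ^+ 4.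
  have -> : 4 * D ^+ 4 = r / e by rewrite /e; field; rewrite ?expf_neq0 ?gt_eqF.
  rewrite /r' ler_wpM2l ?(ltW r0)// lef_pV2 ?posrE//.
  by rewrite (le_trans ev)// ler_peMl.
rewrite -(size_map (fun y => p (g y).2)).
(* All base points lie in [X], so a ball of radius [4 * D ^+ 4] about one of them contains the
   others. *)
apply: le_trans (_ : CP * (4 * D ^+ 4 / (r' / 2)) `^ beta <= _).
  apply: (hCP (p (g y0).2)) => //.
  - by rewrite divr_gt0.
  - by rewrite (le_trans _ r'le)// ler_piMr ?(ltW r'0)// invf_le1// ler1n.
  - apply: (@separated_map _ _ _ _ (fun y => p (g y).2)); first by rewrite divr_gt0.
      exact: filter_uniq.
    move=> y y'; rewrite !mem_filter => /andP[/eqP yv yt] /andP[/eqP y'v y't] yy'.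
    have [Xz yz _ zp] := hg _ yt; have [Xz' yz' _ zp'] := hg _ y't.
    rewrite yv in yz zp; rewrite y'v in yz' zp'.
    apply: (perturbed_separation _ zp zp').
    by apply: (colip_separation Xz Xz' yz yz'); exact: st.
  - move=> _ /mapP[y _ ->]; split=> //.
    have [x Xx <-] := pX (g y).2; have [x' Xx' <-] := pX (g y0).2.
    rewrite (le_lt_trans (cb_diam H (cb_maps H _ Xx) (cb_maps H _ Xx')))//.
    rewrite (le_lt_trans (_ : _ <= D ^+ 4))//; first by rewrite ler_eXnr.
    by rewrite ltr_pMl// ltr1n.
have -> : 4 * D ^+ 4 / (r' / 2) = 8 * D ^+ 5 * (r^-1 * lam v).
  by rewrite /r'; field; rewrite ?mulf_neq0 ?gt_eqF.
rewrite [leLHS](_ : _ = C * r^-1 `^ beta * lam v `^ beta)//.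
rewrite [(8 * D ^+ 5 * _) `^ _]powRM ?mulr_ge0 ?invr_ge0 ?(ltW r0) ?(ltW D0)//.
by rewrite [(r^-1 * _) `^ _]powRM ?invr_ge0 ?(ltW r0)// /C !mulrA.
Qed.

(** When the first piece of [x] is at most of order [rho], so are those of all points of [t]. Points
    with pieces far below [r] are replaced by base points and counted by [packP]; the others are
    grouped by first letter, pulled back, counted by [global_packing] and summed by
    [letters_sum_le]. *)
Lemma local_packing : exists2 C : R, 0 < C & forall om x (r rho : R) (t : seq E),
  coded om x -> 0 < r -> r <= rho -> lam [:: om 0%N] <= D * rho ->
  separated r t -> (forall y, y \in t -> F y /\ `|y - x| < rho) ->
  (size t)%:R <= C * (rho / r) `^ beta.
Proof.
have [C3 C30 hglob] := global_packing.
have [C4 C40 hlet] := letters_sum_le.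
have [CP CP0 hCP] := packing_bound_mono (ltW ab) packP.
have Dn n : 0 < D ^+ n by rewrite exprn_gt0.
have Dn1 n : 1 <= D ^+ n by rewrite exprn_ege1.
pose Cs := CP * (6 * D ^+ 3) `^ beta.
pose Cl := C3 * D `^ beta * C4 * (3 * D ^+ 3) `^ beta.
have Cs0 : 0 < Cs by rewrite mulr_gt0// powR_gt0// mulr_gt0.
have Cl0 : 0 < Cl by rewrite !mulr_gt0// powR_gt0// mulr_gt0.
exists (Cs + Cl); first exact: addr_gt0.
move=> om x r rho t cx r0 rrho lamx [ut st] tF.
have rho0 : 0 < rho by exact: lt_le_trans rrho.
(* Two displacements to base points, at most [D ^+ 3 * rho] each, plus the distance from [x] to
   [y]. *)
pose q := 3 * D ^+ 3 * rho.
have q0 : 0 < q by rewrite !mulr_gt0.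
have first_letter om' y : coded om' y -> exists z, [/\ F z, X z, y = T [:: om' 0%N] z &
    `|y - p (om' 0%N)| <= D ^+ 2 * lam [:: om' 0%N]].
  move=> cy; have [z cz yz] := coded_shift H 1 cy.
  have Xz := codedX cz; have yz' : y = T [:: om' 0%N] z by [].
  exists z; split=> //; first by apply/(limit_setP H); eexists; exact: cz.
  by rewrite yz'; exact: (base_point_near _ Xz).
have stop y : exists iz : I * E, y \in t ->
    [/\ F iz.2, y = T [:: iz.1] iz.2, lam [:: iz.1] <= D * rho &
      `|y - p iz.1| <= D ^+ 2 * lam [:: iz.1]].
  have [i0 _] := cb_index H.
  have [yt|_] := boolP (y \in t); last by exists (i0, 0).
  have [/(limit_setP H) [om' co] yx] := tF _ yt.
  have [z [Fz Xz yz yp]] := first_letter _ _ co.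
  exists (om' 0%N, z) => _ /=; split=> //.
  (* A first letter other than that of [x] is small by separation, since the two pieces come within
     [rho] of each other. *)
  have [<-//|ne] := eqVneq (om 0%N) (om' 0%N).
  have ne' : mkseq om' 1 <> mkseq om 1 by case=> e; rewrite e eqxx in ne.
  have := coded_separation H co cx ne'; rewrite /mkseq /= => /le_trans; apply.
  by rewrite ler_wpM2l ?(ltW D0)// ltW.
have /choice [g hg] := stop.
have near_x y : y \in t -> lam [:: (g y).1] <= q /\ `|p (g y).1 - p (om 0%N)| < q.
  move=> yt; have [_ _ le yp] := hg _ yt; have [_ yx] := tF _ yt.
  have [_ [_ _ _ xp]] := first_letter _ _ cx.
  have D3 : D ^+ 3 = D ^+ 2 * D by rewrite exprSr.
  have l1 : D ^+ 2 * lam [:: (g y).1] <= D ^+ 3 * rho.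
    by rewrite D3 -mulrA ler_wpM2l ?(ltW (Dn 2%N)).
  have l2 : D ^+ 2 * lam [:: om 0%N] <= D ^+ 3 * rho.
    by rewrite D3 -mulrA ler_wpM2l ?(ltW (Dn 2%N)).
  have l3 : rho <= D ^+ 3 * rho by rewrite ler_peMl ?(ltW rho0).
  split.
    rewrite (le_trans le)// /q -mulrA (@le_trans _ _ (D ^+ 3 * rho))//.
      by rewrite ler_wpM2r ?(ltW rho0)// ler_eXnr.
    by rewrite ler_peMl ?ler1n// mulr_ge0 ?(ltW rho0) ?(ltW (Dn 3%N)).
  have h1 := ler_distD y (p (g y).1) (p (om 0%N)).
  have h2 := ler_distD x y (p (om 0%N)).
  rewrite (distrC (p (g y).1) y) in h1.
  rewrite /q; lra.
(* Below this threshold a point is within [D ^+ 2 * lam < r / 4] of its base point, so base points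
   stay [r / 2]-separated. *)
rewrite -(count_predC (fun y => lam [:: (g y).1] < r / (4 * D ^+ 2)) t) natrD.
rewrite [leRHS]mulrDl.
apply: lerD.
  rewrite -size_filter -(size_map (fun y => p (g y).1)).
  apply: le_trans (_ : CP * (q / (r / 2)) `^ beta <= _).
    apply: (hCP (p (om 0%N))) => //.
    - by rewrite divr_gt0.
    - rewrite (@le_trans _ _ r)//; first by rewrite ler_piMr ?(ltW r0)// invf_le1// ler1n.
      rewrite (le_trans rrho)// /q ler_peMl ?(ltW rho0)//.
      by rewrite mulr_ege1// ler1n.
    - apply: (@separated_map _ _ _ _ (fun y => p (g y).1)); first by rewrite divr_gt0.
        exact: filter_uniq.
      have le4 y : y \in t -> lam [:: (g y).1] < r / (4 * D ^+ 2) ->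
          `|y - p (g y).1| <= r / 4.
        move=> yt lt; have [_ _ _ yp] := hg _ yt.
        rewrite (le_trans yp)// mulrC -ler_pdivlMr//.
        rewrite (le_trans (ltW lt))// invfM mulrA lexx//.
      move=> y y'; rewrite !mem_filter => /andP[ly yt] /andP[ly' y't] yy'.
      by apply: (perturbed_separation (st _ _ yt y't yy')); exact: le4.
    - move=> _ /mapP[y + ->]; rewrite mem_filter => /andP[_ yt].
      by split=> //; have [] := near_x _ yt.
  have -> : q / (r / 2) = 6 * D ^+ 3 * (rho / r) by rewrite /q; field; rewrite gt_eqF.
  by rewrite powRM ?mulr_ge0 ?invr_ge0 ?(ltW r0) ?(ltW rho0) ?(ltW D0)// /Cs mulrA.
rewrite -size_filter; set t' := (X in (size X)%:R).
have t'P y : y \in t' -> y \in t /\ r / (4 * D ^+ 2) <= lam [:: (g y).1].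
  by rewrite mem_filter /= -leNgt => /andP[].
have ut' : uniq t' by exact: filter_uniq.
rewrite (size_fibers (fun y => (g y).1)) natr_sum.
set J := undup _.
have JP j : j \in J -> exists2 y, y \in t' & j = (g y).1.
  by rewrite mem_undup => /mapP.
apply: (@le_trans _ _ (\sum_(j <- J) C3 * D `^ beta * r^-1 `^ beta * lam [:: j] `^ beta)).
  rewrite big_seq [leRHS]big_seq; apply: ler_sum => j jJ.
  have rl : r / (4 * D ^+ 2) <= lam [:: j] by have [y /t'P[_ ?] ->] := JP _ jJ.
  have Dj0 : 0 < D * lam [:: j] by rewrite mulr_gt0.
  rewrite -(size_map (fun y => (g y).2)).
  apply: le_trans (_ : C3 * (r / (D * lam [:: j]))^-1 `^ beta <= _).
    apply: hglob.
    - by rewrite divr_gt0.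
    - rewrite ler_pdivrMr// (@le_trans _ _ (4 * D ^+ 2 * lam [:: j]))//.
        by rewrite mulrC -ler_pdivrMr ?mulr_gt0.
      rewrite [leRHS]mulrA ler_wpM2r ?lamge0// -[leRHS]mulrA ler_wpM2l// -exprSr.
      by rewrite ler_weXn2l.
    - apply: (@separated_map _ _ _ _ (fun y => (g y).2)); first by rewrite divr_gt0.
        exact: filter_uniq.
      move=> y y'; rewrite !mem_filter.
      move=> /andP[/eqP yj /andP[_ yt]] /andP[/eqP y'j /andP[_ y't]] yy'.
      have [Fz yz _ _] := hg _ yt; have [Fz' yz' _ _] := hg _ y't.
      rewrite yj in yz; rewrite y'j in yz'.
      by apply: (colip_separation (limit_setX H Fz) (limit_setX H Fz') yz yz'); exact: st.
    - move=> _ /mapP[y + ->]; rewrite mem_filter => /andP[_ /t'P[yt _]].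
      by have [] := hg _ yt.
  rewrite invf_div mulrC [_ / r]mulrC.
  rewrite !powRM ?invr_ge0 ?(ltW r0) ?(ltW D0) ?(ltW Dj0)//.
  rewrite le_eqVlt; apply/orP; left; apply/eqP; ring.
rewrite -mulr_sumr.
apply: (@le_trans _ _ (C3 * D `^ beta * r^-1 `^ beta * (C4 * q `^ beta))).
  rewrite ler_wpM2l//; first by rewrite !mulr_ge0 ?powR_ge0// ltW.
  apply: (hlet (om 0%N)) => //; first exact: undup_uniq.
  by move=> j /JP[y /t'P[yt _] ->]; exact: near_x.
rewrite /q [(3 * D ^+ 3 * rho) `^ _]powRM ?mulr_ge0 ?(ltW rho0) ?(ltW D0)//.
rewrite [(rho / r) `^ _]powRM ?invr_ge0 ?(ltW r0) ?(ltW rho0)// /Cl.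
rewrite le_eqVlt; apply/orP; left; apply/eqP; ring.
Qed.

(** Zooming in by a prefix of the coding of [x] at scale [rho] makes the next letter small enough
    for [local_packing]. *)
Lemma packing_bound_limit_set : packing_bound beta F.
Proof.
have [C3 C30 hglob] := global_packing.
have [CL CL0 hloc] := local_packing.
have D20 : 0 < D ^+ 2 by rewrite exprn_gt0.
pose C := 1 + C3 * D `^ beta + CL * (D ^+ 2) `^ beta.
have C30' : 0 < C3 * D `^ beta by rewrite mulr_gt0// powR_gt0.
have CL0' : 0 < CL * (D ^+ 2) `^ beta by rewrite mulr_gt0// powR_gt0.
exists C; first by rewrite !addr_gt0.
move=> x r rho t /(limit_setP H)[om cx] r0 rrho [ut st] tF.
have rho0 : 0 < rho by exact: lt_le_trans rrho.
have pow0 : 0 <= (rho / r) `^ beta by exact: powR_ge0.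
have weaken c : c <= C -> (size t)%:R <= c * (rho / r) `^ beta ->
    (size t)%:R <= C * (rho / r) `^ beta.
  by move=> cC /le_trans; apply; rewrite ler_wpM2r.
(* A separation above the diameter of [X] leaves at most one point. *)
have [big|rD] := ltP (4 * D ^+ 4) r.
  apply: (weaken 1); first by rewrite /C; lra.
  rewrite mul1r (@le_trans _ _ 1)//; last first.
    have <- : 1 `^ beta = 1 :> R by rewrite powR1.
    by rewrite powR_mono ?(ltW beta0)// ler_pdivlMr// mul1r.
  rewrite lern1; case: t ut st tF {weaken} => [|y [|y' t]]// ut st tF.
  have Fy : F y by have [] := tF y; rewrite ?inE ?eqxx.
  have Fy' : F y' by have [] := tF y'; rewrite ?inE ?eqxx ?orbT.
  have : r <= `|y - y'|.
    apply: st; rewrite ?inE ?eqxx ?orbT//.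
    by move: ut; rewrite /= inE negb_or => /andP[/andP[]].
  move=> /le_trans/(_ (cb_diam H (limit_setX H Fy) (limit_setX H Fy'))).
  rewrite leNgt (le_lt_trans _ big)// (@le_trans _ _ (D ^+ 4))//.
    by rewrite ler_eXnr.
  by rewrite ler_peMl ?ler1n// ltW// exprn_gt0.
have [big|small] := leP 1 (D * rho).
  apply: (weaken (C3 * D `^ beta)); first by rewrite /C; lra.
  have tF' y : y \in t -> F y by move=> /tF[].
  rewrite (le_trans (hglob r t r0 rD (conj ut st) tF'))// -mulrA ler_wpM2l ?(ltW C30)//.
  rewrite -powRM ?(ltW D0) ?divr_ge0 ?(ltW rho0) ?(ltW r0)//.
  rewrite powR_mono ?(ltW beta0) ?invr_ge0 ?(ltW r0)// mulrA.
  by rewrite ler_peMl ?invr_ge0 ?(ltW r0).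
have ex : exists m, lam (mkseq om m.+1) < D * rho.
  have [k hk] := exists_expr_lt (x := xi)
    (introT andP (conj (ltW (cb_xi_gt0 H)) (cb_xi_lt1 H))) (mulr_gt0 D0 rho0).
  exists k; rewrite (le_lt_trans (cb_lam_decay H _))// (le_lt_trans _ hk)//.
  by rewrite size_mkseq ler_wiXn2l ?(ltW (cb_xi_gt0 H)) ?(ltW (cb_xi_lt1 H)).
case: (ex_minnP ex) => m hm mmin; set v := mkseq om m.
have lamv : D * rho <= lam v.
  rewrite /v; case: m {v hm} mmin => [|m] mmin; first by rewrite (cb_lam_nil H) ltW.
  by rewrite leNgt; apply/negP => /mmin; rewrite ltnn.
have [x' cx' xx'] := coded_shift H m cx; rewrite -/v in xx'.
(* As [lam v >= D * rho], a point within [rho] of [x] but with another prefix would violate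
   separation, so all of [t] pulls back through [v]. *)
have pull y : exists z, y \in t -> F z /\ y = T v z.
  have [yt|_] := boolP (y \in t); last by exists 0.
  have [/(limit_setP H)[om' cy] yx] := tF _ yt.
  have [z cz yz] := coded_shift H m cy.
  exists z => _; split; first by apply/(limit_setP H); eexists; exact: cz.
  rewrite yz /v; congr (T _ _); apply: contrapT => ne.
  have := coded_separation H cx cy (nesym ne).
  rewrite leNgt distrC => /negP; apply; rewrite (lt_le_trans _ lamv)//.
  by rewrite ltr_pM2l.
have /choice [g hg] := pull.
have Dv0 : 0 < D * lam v by rewrite mulr_gt0.
apply: (weaken (CL * (D ^+ 2) `^ beta)); first by rewrite /C; lra.
rewrite -mulrA -powRM ?(ltW D20) ?divr_ge0 ?(ltW rho0) ?(ltW r0)//.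
(* Zooming multiplies distances by a factor between [1 / (D * lam v)] and [D / lam v]: the first
   rescales the separation, the second the radius. *)
have -> : D ^+ 2 * (rho / r) = (D * rho / lam v) / (r / (D * lam v)).
  by field; rewrite ?mulf_neq0 ?gt_eqF.
rewrite -(size_map g); apply: (hloc _ x' _ _ _ cx').
- by rewrite divr_gt0.
- have -> : D * rho / lam v = D ^+ 2 * rho / (D * lam v).
    by field; rewrite ?mulf_neq0 ?gt_eqF.
  rewrite ler_pM2r ?invr_gt0// (le_trans rrho)// ler_peMl ?(ltW rho0)//.
  by rewrite exprn_ege1.
- have := cb_lam_cat_ge H v [:: om m]; rewrite /v cats1 -mkseqS -/v addn0 => le.
  rewrite mulrA ler_pdivlMr// mulrC (le_trans le)// ler_wpM2l ?(ltW D0)//.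
  exact: ltW.
- apply: separated_map; first by rewrite divr_gt0.
    exact: ut.
  move=> y y' yt y't yy'; have [Fz yz] := hg _ yt; have [Fz' yz'] := hg _ y't.
  by apply: (colip_separation (limit_setX H Fz) (limit_setX H Fz') yz yz'); exact: st.
- move=> _ /mapP[y yt ->]; have [Fz yz] := hg _ yt; split=> //.
  have [_ yx] := tF _ yt.
  rewrite ltr_pdivlMr// mulrC.
  rewrite (le_lt_trans (cb_colip H v (limit_setX H Fz) (codedX cx')))//.
  by rewrite -yz -xx' ltr_pM2l.
Qed.

End UpperBound.

(** * Lower bounds and conclusion *)

Section LowerBounds.
Context {R : realType} {d : nat} {I : choiceType}.
Local Notation E := 'rV[R]_d.
Implicit Types (A : set E).

(** With a negative exponent the bound decays as [rho] grows, yet a single point is always counted;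
    the chosen [rho] makes the bound [C / (C + 1)]. *)
Lemma packing_bound_ge0 (alpha : R) A : A !=set0 -> packing_bound alpha A -> 0 <= alpha.
Proof.
move=> [x Ax] [C C0 hC]; rewrite leNgt; apply/negP => a0.
have C1 : 1 <= C + 1 by rewrite lerDr ltW.
pose rho := (C + 1) `^ (- alpha)^-1.
have rho1 : 1 <= rho.
  by rewrite -(powRr0 (C + 1)) ler_powR// invr_ge0 oppr_ge0 ltW.
have := hC x 1 rho [:: x] Ax ltr01 rho1.
have -> : (rho / 1) `^ alpha = (C + 1)^-1.
  rewrite divr1 /rho -powRrM invrN mulNr mulVf ?lt_eqF//.
  by rewrite powR_inv1// (le_trans ler01).
move=> /(_ _ _)/= => h; have : 1 <= C / (C + 1).
  apply: h.
    by split=> // y z; rewrite !inE => /eqP -> /eqP ->; rewrite eqxx.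
  move=> y; rewrite inE => /eqP ->; split=> //.
  by rewrite subrr normr0 (lt_le_trans ltr01).
by rewrite ler_pdivlMr ?(lt_le_trans ltr01)// mul1r leNgt ltrDl ltr01.
Qed.

Lemma hausdorff_content_ge0 (s delta : R) A : (0 <= hausdorff_content s delta A)%E.
Proof.
apply: le_ereal_inf_tmp => _ [U [_ _ ->]].
apply: nneseries_ge0 => k _ _; rewrite /diam_pow.
by case: ifP => // _; exact: poweR_ge0.
Qed.

(** At exponent 0 every non-empty set of a cover counts 1, so the content of a non-empty set is at
    least 1. *)
Lemma hausdorff_measure0_gt0 (s : R) A : A !=set0 -> 0 <= s ->
  hausdorff_measure s A = 0%E -> 0 < s.
Proof.
move=> [x Ax] s0 HA; rewrite lt_neqAle s0 andbT; apply/eqP => z.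
have : (hausdorff_content 0 1 A <= 0)%E.
  by rewrite -HA -z; apply: ereal_sup_ubound; exists 1 => //=.
rewrite leNgt => /negP; apply.
apply: (@lt_le_trans _ _ 1%E); first exact: lte01.
apply: le_ereal_inf_tmp => _ [U [AU _ ->]].
have [k _ Uk] := AU _ Ax.
have U0 j : (0 <= diam_pow 0 (U j))%E.
  by rewrite /diam_pow; case: ifP => // _; exact: poweR_ge0.
apply: le_trans (nneseries_lim_ge (m := 0) (P := xpredT) k.+1 _) => //.
rewrite big_mkord big_ord_recr /=.
have -> : diam_pow 0 (U k) = 1%E.
  rewrite /diam_pow ifF ?poweRe0//; apply/negbTE/set0P; by exists x.
by rewrite leeDr// sume_ge0.
Qed.

(** Order [r ^ (- alpha)] balls of radius [r] have an [s]-sum of order [r ^ (s - alpha)], which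
    vanishes with [r]. *)
Lemma hausdorff_measure_of_covering (alpha s B : R) A : (0 < d)%N ->
  A !=set0 -> (forall x y, A x -> A y -> `|x - y| <= B) ->
  covering_bound alpha A -> 0 <= alpha -> alpha < s -> hausdorff_measure s A = 0%E.
Proof.
move=> d0 [x Ax] AB [C C0 hC] a0 as_.
have s0 : 0 < s by exact: le_lt_trans as_.
have dd : 0 < d%:R :> R by rewrite ltr0n.
have B0 : 0 <= B by rewrite (le_trans _ (AB x x Ax Ax)).
apply/eqP; rewrite eq_le; apply/andP; split; last first.
  apply: (le_trans (hausdorff_content_ge0 s 1 A)).
  by apply: ereal_sup_ubound; exists 1 => //=.
apply: ge_ereal_sup => _ [delta /= delta0 <-].
apply/lee_addgt0Pr => eta eta0; rewrite add0e.
pose rho := d%:R * B + 1.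
have rho0 : 0 < rho by rewrite ltr_wpDl// mulr_ge0// ltW.
pose K := (C + 1) * rho `^ alpha * (2 * d%:R) `^ s.
have d20 : 0 < 2 * d%:R :> R by rewrite mulr_gt0.
have K0 : 0 < K.
  by apply: mulr_gt0; [apply: mulr_gt0; [exact: addr_gt0|]|]; rewrite powR_gt0.
have g0 : 0 < s - alpha by rewrite subr_gt0.
(* The three entries give [r < rho], diameters at most [delta] and a total at most [eta]. *)
pose r := Num.min (rho / 2) (Num.min (delta / (2 * d%:R)) ((eta / K) `^ (s - alpha)^-1)).
have r0 : 0 < r.
  by rewrite !lt_min powR_gt0 ?divr_gt0.
have rrho : r < rho.
  by rewrite (@le_lt_trans _ _ (rho / 2)) ?ge_min ?lexx// ltr_pdivrMr// ltr_pMr// ltr1n.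
have rdelta : d%:R * (2 * r) <= delta.
  rewrite mulrCA mulrA -ler_pdivlMl ?mulr_gt0// mulrC.
  by rewrite !ge_min lexx !orbT.
have reta : K * r `^ (s - alpha) <= eta.
  rewrite mulrC -ler_pdivlMr//.
  have -> : eta / K = ((eta / K) `^ (s - alpha)^-1) `^ (s - alpha).
    by rewrite -powRrM mulVf ?gt_eqF// powRr1// divr_ge0 ?ltW.
  by rewrite powR_mono ?(ltW g0) ?(ltW r0)// !ge_min lexx !orbT.
have q1 : 1 <= (rho / r) `^ alpha.
  by rewrite -(powRr0 (rho / r)) ler_powR// ler_pdivlMr// mul1r ltW.
(* The slack from [C] to [C + 1] makes the inequality strict, so the infimum yields an actual finite
   cover. *)
have : (covering_number r (eball x rho `&` A) < ((C + 1) * (rho / r) `^ alpha)%:E)%E.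
  apply: (le_lt_trans (hC x r rho Ax r0 rrho)); rewrite lte_fin.
  by rewrite ltr_pM2r ?ltrDl// (lt_le_trans ltr01).
move=> /ereal_inf_lt[_ [n [c cov] <-]]; rewrite lte_fin => nlt.
pose U (k : nat) := [set y | exists2 k' : 'I_n, k = k' :> nat & eball (c k') r y].
have ediamU k : (ediam (U k) <= (d%:R * (2 * r))%:E)%E.
  apply: ge_ereal_sup => _ [y [z [[i ki yi] [j kj zj] ->]]].
  have ij : i = j by apply: val_inj; rewrite /= -ki -kj.
  have b y' k' : eball (c k') r y' -> `|y' - c k'| < r.
    by apply: le_lt_trans; exact: le_norm_enorm.
  rewrite lee_fin (le_trans (le_enorm_norm _))// ler_wpM2l ?(ltW dd)//.
  rewrite (le_trans (ler_distD (c i) _ _))// mulr_natl mulr2n lerD//.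
    exact/ltW/b.
  by rewrite distrC ij; exact/ltW/b.
apply: (@le_trans _ _ (\sum_(0 <= k <oo) diam_pow s (U k))%E).
  apply: ereal_inf_lbound; exists U; split=> //.
    move=> y Ay; have [|i _ yi] := cov y.
      split=> //; rewrite /eball /= (le_lt_trans (le_enorm_norm _))//.
      by rewrite /rho ltr_pwDr// ler_wpM2l ?(ltW dd)// AB.
    by exists (val i) => //; exists i.
  by move=> k; rewrite (le_trans (ediamU k))// lee_fin.
pose m := d%:R * (2 * r).
have m0 : 0 <= m by rewrite !mulr_ge0 ?ltW.
have dU k : (diam_pow s (U k) <= if (k < n)%N then (m `^ s)%:E else 0)%E.
  rewrite /diam_pow; case: ifP => [_|/negbT/set0P Un].
    by case: ifP => // _; rewrite lee_fin powR_ge0.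
  have [t t0 [dt _]] := ediamP Un (ediamU k).
  rewrite ifT; last by case: Un => y [i -> _]; exact: ltn_ord.
  by rewrite dt poweR_EFin lee_fin powR_mono ?(ltW s0)// -lee_fin -dt ediamU.
have dU0 k : (0 <= diam_pow s (U k))%E.
  by rewrite /diam_pow; case: ifP => // _; exact: poweR_ge0.
apply: lime_le; first exact: is_cvg_nneseries.
apply: nearW => N.
apply: (@le_trans _ _ (\sum_(0 <= k < N) if (k < n)%N then (m `^ s)%:E else 0)%E).
  exact: lee_sum.
rewrite -big_mkcond /= sumEFin lee_fin.
rewrite big_const_seq iter_addr_0 (le_trans _ reta)//.
have cnt : (count (fun k => (k < n)%N) (index_iota 0 N) <= n)%N.
  rewrite -size_filter -[leqRHS](size_iota 0); apply: uniq_leq_size.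
    by rewrite filter_uniq// iota_uniq.
  by move=> k; rewrite mem_filter mem_iota => /andP[].
rewrite -[leLHS]mulr_natl (@le_trans _ _ (n%:R * m `^ s))//.
  by rewrite ler_wpM2r ?powR_ge0// ler_nat.
apply: (le_trans (ler_wpM2r (powR_ge0 _ _) (ltW nlt))).
have -> : m = 2 * d%:R * r by rewrite /m; ring.
rewrite [(2 * d%:R * r) `^ _]powRM ?mulr_ge0 ?(ltW r0)//.
rewrite powRM ?invr_ge0 ?(ltW rho0) ?(ltW r0)//.
have -> : r^-1 `^ alpha = r `^ (- alpha) by rewrite -powR_inv1 ?(ltW r0)// -powRrM mulN1r.
rewrite powRD; last by rewrite (gt_eqF r0) implybT.
rewrite le_eqVlt; apply/orP; left; apply/eqP; rewrite /K; ring.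
Qed.

Context {X : set E} {S : I -> E -> E} {lam : seq I -> R} {D xi : R}.
Hypothesis H : conformal_bounds X S lam D xi.
Local Notation T := (word_map S).
Local Notation F := (limit_set X S).

(* Moving the chosen point of S_i(X) inside S_i(X) changes mutual distances by
   a bounded factor only, as distinct pieces are separated at their own scale. *)
Lemma transport_packing (alpha : R) (P : set E) (p : I -> E) :
  (forall x, P x -> exists i, x = p i) -> (forall i, (T [:: i] @` X) (p i)) ->
  packing_bound alpha F -> packing_bound alpha P.
Proof.
move=> Pp pX [C C0 hC].
have D0 := cb_D_gt0 H; have D1 := cb_D_ge1 H.
have [x0 Fx0] := limit_set_nonempty H.
have X0 := limit_setX H Fx0.
pose q i := T [:: i] x0.
have Fq i : F (q i).
  have /(limit_setP H)[om co] := Fx0; apply/(limit_setP H).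
  by eexists; exact: (coded_cons H i co).
(* Each of the two points moves by at most [D ^+ 2 * lam], which separation bounds by [D ^+ 3] times
   their distance. *)
pose L := 1 + 2 * D ^+ 3.
have L1 : 1 <= L by rewrite lerDl !mulr_ge0 ?exprn_ge0 ?ltW.
have L0 : 0 < L by exact: lt_le_trans L1.
have comp (a b : I -> E) i j : (forall k, (T [:: k] @` X) (a k)) ->
    (forall k, (T [:: k] @` X) (b k)) -> i != j -> `|a i - a j| <= L * `|b i - b j|.
  move=> aX bX ij.
  have nr k : `|a k - b k| <= D ^+ 2 * lam [:: k].
    have [x Xx <-] := aX k; have [y Xy <-] := bX k.
    rewrite (le_trans (cb_lip H [:: k] Xx Xy))// expr2 -mulrA ler_wpM2l ?(ltW D0)//.
    by rewrite mulrC ler_wpM2r ?(cb_lam_ge0 H)// (cb_diam H).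
  have sp k l : k != l -> D ^+ 2 * lam [:: k] <= D ^+ 3 * `|b k - b l|.
    move=> kl; rewrite (exprSr D 2) -mulrA ler_wpM2l ?exprn_ge0 ?(ltW D0)//.
    exact: (base_point_separation H bX).
  have h1 := sp _ _ ij; have h2 := nr i; have h3 := nr j.
  have h4 : D ^+ 2 * lam [:: j] <= D ^+ 3 * `|b i - b j|.
    by rewrite distrC sp// eq_sym.
  have h5 := ler_distD (b i) (a i) (a j); have h6 := ler_distD (b j) (b i) (a j).
  rewrite (distrC (b j)) in h6; rewrite /L mulrDl mul1r -mulrA.
  lra.
have qX i : (T [:: i] @` X) (q i) by exists x0.
have [i0 _] := cb_index H.
have /choice [g hg] y : exists i, P y -> y = p i.
  have [/Pp [i yi]|nP] := pselect (P y); first by exists i.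
  by exists i0.
exists (C * (L ^+ 2) `^ alpha); first by rewrite mulr_gt0// powR_gt0// exprn_gt0.
move=> x r rho t Px r0 rrho [ut st] tP.
have rho0 : 0 < rho by exact: lt_le_trans rrho.
have gne y y' : P y -> P y' -> y != y' -> g y != g y'.
  by move=> /hg {1}-> /hg {1}->; apply: contraNneq => ->.
rewrite -mulrA -powRM ?exprn_ge0 ?(ltW L0) ?divr_ge0 ?(ltW rho0) ?(ltW r0)//.
(* One [L] enlarges the radius, the other shrinks the separation: [comp] is used from [p] to [q] and
   back. *)
have -> : L ^+ 2 * (rho / r) = L * rho / (r / L) by field; rewrite !gt_eqF.
rewrite -(size_map (fun y => q (g y))); apply: (hC (q (g x))) => //.
- by rewrite divr_gt0.
- rewrite ler_pdivrMr// (le_trans rrho)// mulrAC -expr2 ler_peMl ?(ltW rho0)//.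
  exact: exprn_ege1.
- apply: (@separated_map _ _ _ _ (fun y => q (g y))) => //; first by rewrite divr_gt0.
  move=> y y' yt y't yy'; have [Py _] := tP _ yt; have [Py' _] := tP _ y't.
  rewrite ler_pdivrMr// mulrC (le_trans (st _ _ yt y't yy'))//.
  by rewrite {1}(hg _ Py) {1}(hg _ Py') comp// gne.
- move=> _ /mapP[y yt ->]; split=> //; have [Py yx] := tP _ yt.
  have [->|ne] := eqVneq (g y) (g x); first by rewrite subrr normr0 mulr_gt0.
  apply: (le_lt_trans (comp q p _ _ qX pX ne)).
  by rewrite -(hg _ Py) -(hg _ Px) ltr_pM2l.
Qed.

End LowerBounds.

(** * Assembling the two inequalities *)

Lemma lee_dense_ub (R : realType) (a m : \bar R) : (0 <= m)%E ->
  (forall b : R, (m < b%:E)%E -> (a <= b%:E)%E) -> (a <= m)%E.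
Proof.
case: m => [m||] // m0 h; last by rewrite leey.
apply/lee_addgt0Pr => e e0; rewrite -EFinD; apply: h.
by rewrite lte_fin ltrDl.
Qed.

Lemma assouad_dim_limit_set (R : realType) (d : nat) (I : choiceType)
    (X : set 'rV[R]_d) (S : I -> 'rV[R]_d -> 'rV[R]_d) (lam : seq I -> R) (D xi : R)
    (P : set 'rV[R]_d) : (0 < d)%N ->
  conformal_bounds X S lam D xi ->
  P `<=` \bigcup_(i in [set: I]) (S i @` X) ->
  (forall i : I, exists x : 'rV[R]_d, P `&` (S i @` X) = [set x]) ->
  assouad_dim (limit_set X S) =
    Order.max (hausdorff_dim (limit_set X S)) (assouad_dim P).
Proof.
move=> d0 H hP /choice[p hp]; set F := limit_set X S.
have Fne : F !=set0 by exact: limit_set_nonempty H.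
have pp i : (P `&` (S i @` X)) (p i) by rewrite hp.
have Pp i : P (p i) by have [] := pp i.
have pX i : (word_map S [:: i] @` X) (p i) by have [] := pp i.
have Pex x : P x -> exists i, x = p i.
  move=> Px; have [i _ Sx] := hP _ Px; exists i.
  by have : (P `&` (S i @` X)) x by []; rewrite hp.
have FB x y : F x -> F y -> `|x - y| <= D.
  by move=> /(limit_setX H) Xx /(limit_setX H) Xy; exact: (cb_diam H).
apply/eqP; rewrite eq_le; apply/andP; split; last first.
  rewrite ge_max; apply/andP; split.
    (* Null measure is obtained at exponents strictly above [alpha], hence the arbitrary [e]. *)
    apply: le_ereal_inf_tmp => _ [alpha ca <-]; apply/lee_addgt0Pr => e e0.
    have a0 : 0 <= alpha by apply: (packing_bound_ge0 Fne); exact: packing_of_covering.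
    apply: ereal_inf_lbound; exists (alpha + e) => //; split.
      by rewrite addr_ge0// ltW.
    by apply: (hausdorff_measure_of_covering d0 Fne FB ca a0); rewrite ltrDl.
  apply: le_ereal_inf_tmp => _ [alpha ca <-]; apply: ereal_inf_lbound; exists alpha => //.
  apply: (covering_of_packing d0); apply: (transport_packing H Pex pX).
  exact: packing_of_covering.
apply: lee_dense_ub.
  rewrite le_max; apply/orP; left.
  by apply: le_ereal_inf_tmp => _ [s [s0 _] <-]; rewrite lee_fin.
(* A real [beta] above the maximum exceeds both some [s] with null measure and some [alpha]
   admissible for [P]. *)
move=> beta; rewrite gt_max => /andP[].
move=> /ereal_inf_lt[_ [s [s0 Hs] <-]]; rewrite lte_fin => sb.
move=> /ereal_inf_lt[_ [alpha ca <-]]; rewrite lte_fin => ab.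
have sgt0 := hausdorff_measure0_gt0 Fne s0 Hs.
apply: ereal_inf_lbound; exists beta => //; apply: (covering_of_packing d0).
apply: (packing_bound_limit_set H (s := s) (alpha := alpha) (P := P) (p := p)) => //.
- by move=> Q n uQ sQ; apply: (level_sum_le H sgt0 Hs uQ) sQ.
- exact: packing_of_covering.
- exact: lt_trans sb.
Qed.

Theorem theorem3p1 (R : realType) (d : nat) (I : Type)
    (X : set 'rV[R]_d) (S : I -> 'rV[R]_d -> 'rV[R]_d)
    (V : set 'rV[R]_d) (Sbar : I -> 'rV[R]_d -> 'rV[R]_d)
    (P : set 'rV[R]_d)
    (hS : is_CIFS X S V Sbar)
    (hV : forall i j : I, i <> j -> (Sbar i @` V) `&` (Sbar j @` V) = set0)
    (hP : P `<=` \bigcup_(i in [set: I]) (S i @` X))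
    (hP1 : forall i : I, exists x : 'rV[R]_d, P `&` (S i @` X) = [set x]) :
  assouad_dim (limit_set X S) =
    Order.max (hausdorff_dim (limit_set X S)) (assouad_dim P).
Proof.
have [lam [D [xi H]]] := CIFS_conformal_bounds hS hV.
(* Words are compared and collected in duplicate-free lists, so the index type takes its classical
   choice structure. *)
exact: (@assouad_dim_limit_set R d {classic I} X S lam D xi P (cifs_dim hS) H hP hP1).
Qed.
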